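(* Let $a_0,b_0\ge1$ and $c\ge 1$ be integers, and let $(\mathbb{Y}^c_n)_{n\ge 0}$ be the Pólya walk with up-step $(0,c)$ and right-step $(c,0)$ starting from $(a_0,b_0)$. Then \[ \lim_{N\to\infty}\frac1N\sum_{n=1}^N I(\mathbb{Y}^c_n)=\Delta(a_0,b_0;c,c)\quad\text{almost surely}, \] where $\Delta(a_0,b_0;c,c)$ is the constant \[ \Delta(a_0,b_0;c,c)=\sum_{\substack{d\ge1\\ \gcd(d,c)\,\mid\,\gcd(a_0,b_0)}}\frac{\mu(d)}{d^2}\,\gcd(d,c)^2 . \]
   Context: $\mathbb{N}=\{1,2,3,\dots\}$ and $\mu$ is the Möbius function. The Pólya walk with up-step $(0,c)$ and right-step $(c,0)$ starting from $(a_0,b_0)\in\mathbb{N}^2$ is the discrete-time stochastic process $(\mathbb{Y}^c_n)_{n\ge0}$ in $\mathbb{N}^2$ with deterministic start $\mathbb{Y}^c_0=(a_0,b_0)$ such that, for each $n\ge 0$, given the history up to time $n$ with current position $\mathbb{Y}^c_n=(a_n,b_n)$, the jump $\mathbb{Y}^c_{n+1}-\mathbb{Y}^c_n$ equals $(c,0)$ with conditional probability $\frac{a_n}{a_n+b_n}$ and $(0,c)$ with conditional probability $\frac{b_n}{a_n+b_n}$. The function $I:\mathbb{N}^2\to\{0,1\}$ is given by $I(x,y)=1$ if $\gcd(x,y)=1$ and $I(x,y)=0$ otherwise. *)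

(* Defs.v *)
From mathcomp Require Import all_boot all_order all_algebra.
From mathcomp Require Import all_classical all_reals all_analysis.
Set Implicit Arguments.
Unset Strict Implicit.
Unset Printing Implicit Defensive.
Import Order.TTheory GRing.Theory Num.Theory.
Import numFieldNormedType.Exports.
Local Open Scope classical_set_scope.
Local Open Scope ring_scope.

(* The value at 0 is junk and is never used. *)
Definition moebius (n : nat) : int :=
  if all (fun p => logn p n == 1%N) (primes n)
  then (-1) ^+ size (primes n) else 0.

(* The elementary conditional probability P(A | B); meaningful only when
   P(B) > 0 (it evaluates to 0 otherwise). *)
Definition cond_prob d (T : measurableType d) (R : realType)
    (P : probability T R) (A B : set T) : R :=
  fine (P (A `&` B)) / fine (P B).

Definition history T (Y : nat -> T -> nat * nat) (n : nat)
    (y : nat -> nat * nat) : set T :=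
  [set w | forall k, (k <= n)%N -> Y k w = y k].

(* The state space is countable and discrete, so conditioning on the history
   up to time n amounts to conditioning on each path prefix y_0, ..., y_n
   that has positive probability. Points of the state space {1, 2, ...}^2 are
   encoded as pairs of positive natural numbers. *)
Record polya_walk d (T : measurableType d) (R : realType)
    (P : probability T R) (a0 b0 c : nat)
    (Y : nat -> {RV P >-> (nat * nat)%type}) : Prop := {
  polya_pos : forall n w, ((0 < (Y n w).1) && (0 < (Y n w).2))%N ;
  polya_start : forall w, Y 0 w = (a0, b0) ;
  polya_right : forall n y, (0 < P (history Y n y))%E ->
    let a := (y n).1 in let b := (y n).2 in
    cond_prob P [set w | Y n.+1 w = ((a + c)%N, b)] (history Y n y)
      = a%:R / (a + b)%:R ;
  polya_up : forall n y, (0 < P (history Y n y))%E ->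
    let a := (y n).1 in let b := (y n).2 in
    cond_prob P [set w | Y n.+1 w = (a, (b + c)%N)] (history Y n y)
      = b%:R / (a + b)%:R }.

Definition coprime_ind (p : nat * nat) : nat := coprime p.1 p.2.

Definition Delta_partial (R : realType) (a b c N : nat) : R :=
  \sum_(1 <= d < N.+1 | (gcdn d c %| gcdn a b)%N)
    (moebius d)%:~R / (d ^ 2)%:R * (gcdn d c ^ 2)%:R.

(* The series converges absolutely: its terms are bounded by c ^ 2 / d ^ 2. *)
Definition Delta (R : realType) (a b c : nat) : R :=
  limn (Delta_partial R a b c).

(* Main.v *)
Require Import Defs.
From mathcomp Require Import all_boot all_order all_algebra.
From mathcomp Require Import all_classical all_reals all_analysis.
From mathcomp Require Import measurable_realfun.
From mathcomp Require Import ring lra zify.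
Import Order.TTheory GRing.Theory Num.Theory.
Import numFieldNormedType.Exports.
Local Open Scope classical_set_scope.
Local Open Scope ring_scope.
Set Implicit Arguments.
Unset Strict Implicit.


(** The value [I(x, y)] is the sum of [mu(d)] over the common divisors [d] of
    [x] and [y], so the average of [I] along the walk is the sum over [d] of
    [mu(d)] times the frequency of the times at which [d] divides both
    coordinates. The theorem holds because, for every [d], this frequency tends
    to the term of the series without [mu(d)], and because the large [d]
    contribute little, uniformly in time.

    Frequency of one [d]. If [K] right-steps and [J] up-steps have been made,
    then [d] divides [a0 + c K] and [b0 + c J] exactly when [(K, J)] lies in one
    residue class modulo [e = d / gcd(d, c)], provided that [gcd(d, c)] divides
    [a0] and [b0]; otherwise it never does ([affine_residue]). It remains to see
    that [(K, J)] is equidistributed modulo [e]. During the block of times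
    [b^2, ..., (b + 1)^2 - 1] the probability [p] of a right-step hardly moves,
    so the empirical law [f] of [(K, J)] in the block satisfies
    [f(x) = p f(x - right) + q f(x - up)] up to a defect whose mean square is
    [O(1/b)]: martingale noise plus the drift of [p] ([mean_block_defect]).
    Strict convexity of the Euclidean norm turns this into a bound on the
    difference between [f] and its two translates, hence on the distance from
    [f] to the uniform law ([torus_equidistribution]). Every bound is polynomial
    in [e], so all [d <= D] can be treated together ([main_error]).

    Large [d]. The function [1/a + 1/b] bounds, up to a constant factor, the
    probability of being at [(a, b)] at a given time, since it solves the forward
    equation of the walk ([point_mass]). Summing over the multiples of [d], the
    probability that [d] divides both coordinates at time [n] is
    [O(log n / d)], and it vanishes unless [d] divides the deterministic number
    [a0 + b0 + c n]; the [d > D] thus contribute [O(log N / D)] to the mean up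
    to time [N] ([mean_tail_error]).

    Almost sure convergence. With [D = k^3] and [N = k^82] both errors have mean
    [O(1/k^2)], hence tend to 0 almost surely ([word_borel_cantelli]); since
    consecutive values of [N] have ratio tending to 1, the intermediate times
    follow ([subsequence_average]). The equidistribution bound loses a factor
    [(p q)^-2], so [p] and [q] have to stay away from 0 almost surely. The sum
    of the [1/(a0 + c i)] over [i < K] minus the sum of the [1/(a0 + b0 + c l)]
    over [l < n] is a martingale; its square plus [2/a] is a nonnegative
    supermartingale, bounded by the maximal inequality, and comparison with
    logarithms then bounds [(a + b)/a] ([coord_lower_bound]).

    Expectations are computed on histories, that is, lists of steps, by the
    recursion [mean]; [expectation_word] identifies them with integrals. *)

(** * Almost invariant laws on a discrete torus *)

Section Energy.
Variables (R : rcfType) (G : finType) (f : G -> R) (p q : R) (sg rh : G -> G).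
Hypotheses (f_ge0 : forall x, 0 <= f x) (sum_f : \sum_x f x = 1).
Hypotheses (p_ge0 : 0 <= p) (q_ge0 : 0 <= q) (pq1 : p + q = 1).
Hypotheses (sg_inj : injective sg) (rh_inj : injective rh).

Let defect x := f x - p * f (sg x) - q * f (rh x).
Let S := \sum_x defect x ^+ 2.
Let gap := \sum_x (f (sg x) - f (rh x)) ^+ 2.

Lemma prob_le1 x : f x <= 1.
Proof. by rewrite -sum_f (bigD1 x) //= lerDl sumr_ge0. Qed.

Lemma sum_sq_le1 : \sum_x f x ^+ 2 <= 1.
Proof.
rewrite -sum_f; apply: ler_sum => x _.
by rewrite expr2 ler_piMr // prob_le1.
Qed.

(** Averaging two translates loses exactly [p q] times their squared distance,
    because [p + q = 1]. *)
Lemma energy_identity :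
  \sum_x (p * f (sg x) + q * f (rh x)) ^+ 2 = \sum_x f x ^+ 2 - p * q * gap.
Proof.
have -> : \sum_x f x ^+ 2 =
    \sum_x (p * f (sg x) ^+ 2 + q * f (rh x) ^+ 2).
  have inv (s : G -> G) : injective s -> \sum_x f (s x) ^+ 2 = \sum_x f x ^+ 2.
    by move=> sI; rewrite [RHS](reindex_inj sI).
  by rewrite big_split /= -!mulr_sumr !inv // -mulrDl pq1 mul1r.
rewrite /gap mulr_sumr -sumrB; apply: eq_bigr => x _.
have -> : q = 1 - p by rewrite -pq1 [p + q]addrC addrK.
ring.
Qed.

(** If [f] nearly equals the average of its translates, then the loss in
    [energy_identity] is nearly 0, so the translates are close to each other. *)
Lemma gap_sq_le : (p * q * gap) ^+ 2 <= 4 * S.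
Proof.
have pq0 : 0 <= p * q by rewrite mulr_ge0.
have gap0 : 0 <= gap by apply: sumr_ge0 => x _; rewrite sqr_ge0.
set m := \sum_x f x * defect x.
have le1 : p * q * gap <= 2 * m.
  have S0 : 0 <= S by apply: sumr_ge0 => x _; rewrite sqr_ge0.
  have : \sum_x (f x - defect x) ^+ 2 = \sum_x f x ^+ 2 - p * q * gap.
    by rewrite -energy_identity; apply: eq_bigr => x _; rewrite /defect; ring.
  have -> : \sum_x (f x - defect x) ^+ 2 = \sum_x f x ^+ 2 - 2 * m + S.
    rewrite /S /m mulr_sumr -sumrB -big_split /=.
    by apply: eq_bigr => x _; ring.
  by move=> h; lra.
(* Jensen's inequality for the weights [f], and [f <= 1]. *)
have le2 : m ^+ 2 <= S.
  have hm : \sum_x f x * defect x = m by [].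
  clearbody m.
  have : 0 <= \sum_x f x * (defect x - m) ^+ 2.
    by apply: sumr_ge0 => x _; rewrite mulr_ge0 ?sqr_ge0.
  have -> : \sum_x f x * (defect x - m) ^+ 2 =
      \sum_x f x * defect x ^+ 2 - m ^+ 2.
    transitivity (\sum_x f x * defect x ^+ 2 -
        2 * m * (\sum_x f x * defect x) + m ^+ 2 * \sum_x f x).
      rewrite !mulr_sumr -sumrB -big_split /=.
      by apply: eq_bigr => x _; ring.
    by rewrite sum_f hm; ring.
  rewrite subr_ge0 => /le_trans; apply; apply: ler_sum => x _.
  by rewrite ler_piMl ?sqr_ge0 ?prob_le1.
apply: (@le_trans _ _ ((2 * m) ^+ 2)); last by rewrite exprMn; lra.
by rewrite ler_sqr ?nnegrE //;
  [rewrite mulr_ge0 | apply: le_trans le1; rewrite mulr_ge0].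
Qed.

Lemma defects_le4 : S <= 4.
Proof.
have gap0 : 0 <= gap by apply: sumr_ge0 => x _; rewrite sqr_ge0.
have pq0 : 0 <= p * q by rewrite mulr_ge0.
have pqg : 0 <= p * q * gap by rewrite mulr_ge0.
have h : S <= \sum_x (2 * f x ^+ 2 + 2 * (p * f (sg x) + q * f (rh x)) ^+ 2).
  apply: ler_sum => x _; rewrite /defect -subr_ge0.
  have := sqr_ge0 (f x + (p * f (sg x) + q * f (rh x))).
  by move=> ?; nra.
apply: (le_trans h); rewrite big_split /= -!mulr_sumr energy_identity.
by have := sum_sq_le1; lra.
Qed.

Let m := Num.sqrt (2 * (gap + S)).

(** [f x - f (sg x)] is the defect at [x] minus [q] times the difference of the
    two translates, and both have been bounded. *)
Lemma right_step_le x : `|f x - f (sg x)| <= m.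
Proof.
rewrite -sqrtr_sqr ler_sqrt; last first.
  by rewrite mulr_ge0 // addr_ge0 //; apply: sumr_ge0 => y _; rewrite sqr_ge0.
have le_gap : (f (sg x) - f (rh x)) ^+ 2 <= gap.
  by rewrite /gap (bigD1 x) //= lerDl sumr_ge0 // => y _; rewrite sqr_ge0.
have le_S : defect x ^+ 2 <= S.
  by rewrite /S (bigD1 x) //= lerDl sumr_ge0 // => y _; rewrite sqr_ge0.
have -> : f x - f (sg x) = defect x - q * (f (sg x) - f (rh x)).
  rewrite /defect; have -> : p = 1 - q by rewrite -pq1 addrK.
  ring.
set g := f (sg x) - f (rh x) in le_gap *.
have q1 : q <= 1 by rewrite -pq1 lerDr.
have qg : (q * g) ^+ 2 <= g ^+ 2.
  by rewrite exprMn ler_piMl ?sqr_ge0 // expr_le1.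
have := sqr_ge0 (defect x + q * g).
by move: (q * g) qg (defect x) le_S => a ? b ?; nra.
Qed.

End Energy.

Lemma up_step_le (R : rcfType) (G : finType) (f : G -> R) (p q : R)
    (sg rh : G -> G) :
  0 <= p -> 0 <= q -> p + q = 1 -> forall x,
  `|f x - f (rh x)| <= Num.sqrt (2 * (\sum_x (f (sg x) - f (rh x)) ^+ 2 +
      \sum_x (f x - p * f (sg x) - q * f (rh x)) ^+ 2)).
Proof.
move=> p0 q0 pq1 x.
have := @right_step_le R G f q p rh sg q0 p0 (etrans (addrC q p) pq1) x.
congr (_ <= Num.sqrt (_ * (_ + _))); apply: eq_bigr => y _; first by ring.
by congr (_ ^+ 2); ring.
Qed.

Definition back_right e (x : 'I_e.+1 * 'I_e.+1) := (x.1 - inZp 1, x.2).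
Definition back_up e (x : 'I_e.+1 * 'I_e.+1) := (x.1, x.2 - inZp 1).

Section Torus.
Variables (R : rcfType) (e : nat).
Let G := ('I_e.+1 * 'I_e.+1)%type.
Local Notation r := (@back_right e).
Local Notation u := (@back_up e).

(** Any two points of the torus are joined by fewer than [2 (e + 1)] unit
    steps. *)
Lemma torus_chain (f : G -> R) (m : R) :
  (forall x, `|f x - f (r x)| <= m) -> (forall x, `|f x - f (u x)| <= m) ->
  forall x y, `|f x - f y| <= (2 * e.+1)%:R * m.
Proof.
move=> hr hu x y.
have chain (z : G -> G) : (forall x, `|f x - f (z x)| <= m) ->
    forall k x, `|f x - f (iter k z x)| <= k%:R * m.
  move=> hz; elim=> [|k IH] w; first by rewrite subrr normr0 mul0r.
  have -> : f w - f (iter k.+1 z w) =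
     (f w - f (iter k z w)) + (f (iter k z w) - f (z (iter k z w))).
    by rewrite addrA subrK.
  by rewrite -natr1 mulrDl mul1r (le_trans (ler_normD _ _)) // lerD.
have m0 : 0 <= m by apply: le_trans (hr (0, 0)).
have inZpS k : inZp k.+1 = inZp k + inZp 1 :> 'I_e.+1.
  by apply: val_inj; rewrite /= modnDm addn1.
have inZp0 : inZp 0 = 0 :> 'I_e.+1 by apply: val_inj; rewrite /= mod0n.
have rk k : iter k r x = (x.1 - inZp k, x.2).
  elim: k => [|k IH] /=; first by rewrite inZp0 subr0 -surjective_pairing.
  by rewrite IH /back_right /= (inZpS k) opprD addrA.
have uk k w : iter k u w = (w.1, w.2 - inZp k).
  elim: k => [|k IH] /=; first by rewrite inZp0 subr0 -surjective_pairing.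
  by rewrite IH /back_up /= (inZpS k) opprD addrA.
pose k1 : 'I_e.+1 := x.1 - y.1; pose k2 : 'I_e.+1 := x.2 - y.2.
have -> : f x - f y = (f x - f (iter k1 r x)) +
    (f (iter k1 r x) - f (iter k2 u (iter k1 r x))).
  rewrite addrA subrK; congr (_ - f _).
  by rewrite uk rk !valZpK !subKr; case: (y).
apply: le_trans (ler_normD _ _) _; rewrite mul2n -addnn natrD mulrDl.
have le_k (i : 'I_e.+1) : i%:R * m <= e.+1%:R * m.
  by rewrite ler_wpM2r // ler_nat ltnW // ltn_ord.
by apply: lerD; apply: le_trans (le_k _); [exact: (chain r hr) | exact: (chain u hu)].
Qed.

(** A law that is almost stationary for the walk with steps right and up is
    almost uniform. The fourth power comes from the quadratic dependence of
    [gap_sq_le] on the squared distance of the translates; the factor [p q]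
    cannot be avoided, as a walk that only goes right is stationary on each
    row. *)
Lemma torus_equidistribution (f : G -> R) (p q : R) :
  (forall x, 0 <= f x) -> \sum_x f x = 1 -> 0 <= p -> 0 <= q -> p + q = 1 ->
  forall x0, (p * q) ^+ 2 * (f x0 - ((e.+1) ^ 2)%:R^-1) ^+ 4 <=
   1024 * e.+1%:R ^+ 4 * \sum_(x : G) (f x - p * f (r x) - q * f (u x)) ^+ 2.
Proof.
move=> f0 f1 p0 q0 pq1 x0.
have rI : injective r.
  move=> a b h; apply: injective_projections; last exact: (congr1 snd h).
  exact: (addIr _ (congr1 fst h)).
have uI : injective u.
  move=> a b h; apply: injective_projections; first exact: (congr1 fst h).
  exact: (addIr _ (congr1 snd h)).
set S := \sum_(x : G) _.
set gap := \sum_(x : G) (f (r x) - f (u x)) ^+ 2.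
set m := Num.sqrt (2 * (gap + S)).
have hr x := @right_step_le R G f p q r u p0 q0 pq1 x; rewrite -/m in hr.
have hu x := @up_step_le R G f p q r u p0 q0 pq1 x; rewrite -/m in hu.
have hgap := @gap_sq_le R G f p q r u f0 f1 p0 q0 pq1 rI uI; rewrite -/gap -/S in hgap.
have hS := @defects_le4 R G f p q r u f0 f1 p0 q0 pq1 rI uI; rewrite -/S in hS.
have gap0 : 0 <= gap by apply: sumr_ge0 => y _; rewrite sqr_ge0.
have S0 : 0 <= S by apply: sumr_ge0 => y _; rewrite sqr_ge0.
have hx := @torus_chain f m hr hu x0.
set N : R := (e.+1 ^ 2)%:R.
have N0 : 0 < N by rewrite ltr0n expn_gt0.
(* [N^-1] is the mean of [f], so the deviation is a mean of differences. *)
have dev : `|f x0 - N^-1| <= (2 * e.+1)%:R * m.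
  have -> : f x0 - N^-1 = N^-1 * \sum_y (f x0 - f y).
    rewrite sumrB f1 sumr_const card_prod card_ord mulrBr mulr1 -[f x0 *+ _]mulr_natl.
    by rewrite mulnn -/N mulKf // gt_eqF.
  rewrite normrM ger0_norm ?invr_ge0 ?(ltW N0) // ler_pdivrMl //.
  apply: le_trans (ler_norm_sum _ _ _) _.
  apply: le_trans (ler_sum _ (fun y _ => hx y)) _.
  by rewrite sumr_const card_prod card_ord mulnn -[_ *+ (_ ^ _)]mulr_natl.
have dev4 : (f x0 - N^-1) ^+ 4 <= (2 * e.+1)%:R ^+ 4 * m ^+ 4.
  rewrite -exprMn -[X in X <= _](@ger0_norm _ _) ?normrX; last first.
    by rewrite (exprM _ 2 2) sqr_ge0.
  by rewrite lerXn2r // nnegrE mulr_ge0 ?sqrtr_ge0.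
have m4 : m ^+ 4 = (2 * (gap + S)) ^+ 2.
  by rewrite (exprM _ 2 2) sqr_sqrtr // mulr_ge0 // addr_ge0.
have pqm : (p * q) ^+ 2 * m ^+ 4 <= 64 * S.
  rewrite m4.
  have pq0 : 0 <= p * q by rewrite mulr_ge0.
  have pq_le1 : p * q <= 1 by rewrite mulr_ile1 // -pq1 ?lerDl ?lerDr.
  have a1 : (p * q) ^+ 2 * S ^+ 2 <= 4 * S.
    apply: (@le_trans _ _ (1 * (4 * S))); last by rewrite mul1r.
    apply: ler_pM; rewrite ?sqr_ge0 ?expr_le1 //.
    by rewrite expr2 ler_wpM2r.
  have a2 : (p * q) ^+ 2 * (2 * (gap + S)) ^+ 2 <=
      8 * (p * q * gap) ^+ 2 + 8 * ((p * q) ^+ 2 * S ^+ 2).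
    have := sqr_ge0 (p * q * (gap - S)).
    move=> ?; rewrite -subr_ge0; nra.
  lra.
apply: (@le_trans _ _ ((p * q) ^+ 2 * ((2 * e.+1)%:R ^+ 4 * m ^+ 4))).
  by rewrite ler_wpM2l // sqr_ge0.
rewrite mulrCA.
apply: (@le_trans _ _ ((2 * e.+1)%:R ^+ 4 * (64 * S))).
  by rewrite ler_wpM2l // exprn_ge0.
rewrite le_eqVlt; apply/orP; left; apply/eqP.
by rewrite natrM; ring.
Qed.

End Torus.

(** * Divisors and residues *)
Lemma moebius_square_divisor p d :
  prime p -> (0 < d)%N -> (p ^ 2 %| d)%N -> moebius d = 0.
Proof.
move=> p_pr d0 pd; rewrite /moebius; case: allP => // h.
have p2 : (2 <= logn p d)%N by rewrite -pfactor_dvdn.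
have : p \in primes d by rewrite -logn_gt0 ltnW.
by move=> /h /eqP l1; rewrite l1 in p2.
Qed.

Lemma moebiusM_prime p d : prime p -> (0 < d)%N -> ~~ (p %| d)%N ->
  moebius (p * d) = - moebius d.
Proof.
move=> p_pr d0 pd; have p0 := prime_gt0 p_pr.
have pr_perm : perm_eq (primes (p * d)) (p :: primes d).
  apply: uniq_perm; first exact: primes_uniq.
    by rewrite /= primes_uniq andbT mem_primes p_pr d0.
  by move=> q; rewrite primesM // inE primes_prime // inE.
rewrite /moebius (perm_size pr_perm) (perm_all _ pr_perm) /=.
have -> : logn p (p * d) = 1%N.
  by rewrite lognM // logn_prime // eqxx [logn p d]lognE (negPf pd) !andbF.
rewrite /= -[RHS]mulN1r.
have -> : all (fun q => logn q (p * d) == 1%N) (primes d) =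
   all (fun q => logn q d == 1%N) (primes d).
  apply: eq_in_all => q; rewrite mem_primes => /and3P[q_pr _ qd].
  rewrite lognM // logn_prime //.
  by have -> : (q == p) = false by apply: contraNF pd => /eqP <-.
by case: ifP => _; rewrite ?mulr0 // exprS.
Qed.

(** For a prime [p] dividing [n], multiplication by [p] pairs the divisors prime
    to [p] with those exactly divisible by [p], and [moebius] changes sign. *)
Lemma sum_moebius_divisors n : (0 < n)%N ->
  \sum_(d <- divisors n) moebius d = (n == 1)%N.
Proof.
move=> n0; case: (eqVneq n 1%N) => [->|n1].
  by rewrite (_ : divisors 1 = [:: 1%N]) // big_seq1.
have p_pr : prime (pdiv n) by rewrite pdiv_prime // ltn_neqAle eq_sym n1.
have pn := pdiv_dvd n; move: (pdiv n) p_pr pn => p p_pr pn.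
have p0 := prime_gt0 p_pr.
rewrite (bigID (fun d => p %| d)%N) /= addrC.
rewrite [X in _ + X](bigID (fun d => p ^ 2 %| d)%N) /= [X in _ + (X + _)]big1_seq; last first.
  move=> d /andP[/andP[_ pd]]; rewrite -dvdn_divisors // => dn.
  by apply: (moebius_square_divisor p_pr) => //; apply: dvdn_gt0 dn.
rewrite add0r -big_filter -[X in _ + X]big_filter.
have pe : perm_eq [seq d <- divisors n | (p %| d)%N && ~~ (p ^ 2 %| d)%N]
    [seq (p * d)%N | d <- [seq d <- divisors n | ~~ (p %| d)%N]].
  apply: uniq_perm; first by rewrite filter_uniq // divisors_uniq.
    rewrite map_inj_uniq ?filter_uniq ?divisors_uniq //.
    by move=> x y /eqP; rewrite eqn_pmul2l // => /eqP.
  move=> d; rewrite mem_filter -dvdn_divisors //; apply/idP/mapP.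
    case/andP=> /andP[/dvdnP[k ->]]; rewrite -mulnn dvdn_pmul2r // => pk dn.
    exists k; last by rewrite mulnC.
    by rewrite mem_filter pk -dvdn_divisors // (dvdn_trans _ dn) // dvdn_mulr.
  case=> k; rewrite mem_filter -dvdn_divisors // => /andP[pk kn] ->.
  rewrite dvdn_mulr //= -mulnn dvdn_pmul2l // pk /=.
  by rewrite Gauss_dvd ?pn // prime_coprime.
rewrite (perm_big _ pe) /= big_map -big_split /= big_seq big1 // => d.
rewrite mem_filter -dvdn_divisors // => /andP[pd dn].
by rewrite moebiusM_prime ?subrr // (dvdn_gt0 n0 dn).
Qed.

(** The range up to an arbitrary [M >= n] lets one range of divisors serve for
    all the positions up to a given time. *)
Lemma sum_moebius n M : (0 < n)%N -> (n <= M)%N ->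
  \sum_(1 <= d < M.+1 | (d %| n)%N) moebius d = (n == 1)%N.
Proof.
move=> n0 nM; rewrite -(sum_moebius_divisors n0) -big_filter; apply: perm_big.
apply: uniq_perm; rewrite ?filter_uniq ?divisors_uniq ?iota_uniq //.
move=> d; rewrite mem_filter mem_index_iota -dvdn_divisors //.
apply: andb_idr => dn; rewrite (dvdn_gt0 n0 dn) /= ltnS.
exact: leq_trans (dvdn_leq n0 dn) nM.
Qed.

Lemma moebius_norm (R : realType) d : `|(moebius d)%:~R : R| <= 1.
Proof.
rewrite /moebius; case: ifP => _; last by rewrite normr0.
by rewrite rmorphXn /= normrX normrN1 expr1n.
Qed.

Lemma eqn_modMl_coprime e k i j : coprime e k ->
  ((k * i)%N == (k * j)%N %[mod e]) = (i == j %[mod e]).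
Proof.
move=> ek; wlog ij : i j / (i <= j)%N.
  by move=> h; case/orP: (leq_total i j) => /h // h'; rewrite eq_sym h' eq_sym.
rewrite eq_sym [RHS]eq_sym !eqn_mod_dvd ?leq_mul2l ?ij ?orbT //.
by rewrite -mulnBr Gauss_dvdr.
Qed.

(** After division by the gcd, the coefficient of [x] becomes invertible modulo
    the period [d / gcd(d, k)]; the solution is provided by the Chinese
    remainder theorem. *)
Lemma affine_residue d a k : (0 < d)%N -> (gcdn d k %| a)%N ->
  {i : 'I_(d %/ gcdn d k).-1.+1 | forall x, (d %| a + k * x)%N = (inZp x == i)}.
Proof.
move=> d0; set g := gcdn d k => ga.
have g0 : (0 < g)%N by rewrite gcdn_gt0 d0.
have [e dE] : {e | d = (e * g)%N} by exists (d %/ g)%N; rewrite divnK // dvdn_gcdl.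
have [l kE] : {l | k = (l * g)%N} by exists (k %/ g)%N; rewrite divnK // dvdn_gcdr.
have [b aE] : {b | a = (b * g)%N} by exists (a %/ g)%N; rewrite divnK.
have e0 : (0 < e)%N by move: d0; rewrite dE muln_gt0 => /andP[].
have el : coprime e l.
  rewrite /coprime -(eqn_pmul2r g0) mul1n muln_gcdl -dE -kE //.
have -> : (d %/ g)%N = e by rewrite dE mulnK.
pose y := chinese e l (b * e.-1) 0.
have yl : (l %| y)%N by rewrite /dvdn chinese_modr // mod0n.
have ye : (e %| b + y)%N.
  rewrite /dvdn -modnDmr chinese_modl // modnDmr -mulnS prednK //.
  by rewrite modnMl.
exists (inZp (y %/ l)) => x.
have -> : (d %| a + k * x)%N = (e %| b + l * x)%N.
  by rewrite dE aE kE mulnAC -mulnDl dvdn_pmul2r.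
have -> : (e %| b + l * x)%N = (b + l * x == b + l * (y %/ l) %[mod e])%N.
  by rewrite [(l * (_ %/ _))%N]mulnC divnK // (eqP ye).
rewrite eqn_modDl eqn_modMl_coprime //.
by rewrite -(inj_eq val_inj) /= prednK.
Qed.

Lemma affine_no_residue d a k x : ~~ (gcdn d k %| a)%N -> (d %| a + k * x)%N = false.
Proof.
move=> ga; apply: contraNF ga => da.
have : (gcdn d k %| a + k * x)%N by rewrite (dvdn_trans _ da) // dvdn_gcdl.
by rewrite dvdn_addl // dvdn_mulr // dvdn_gcdr.
Qed.

(** * Series and averages of real sequences *)
Lemma harmonic_dyadic (R : realType) j : \sum_(1 <= i < 2 ^ j) i%:R^-1 <= j%:R :> R.
Proof.
elim: j => [|j IH]; first by rewrite big_geq.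
rewrite (@big_cat_nat _ _ _ (2 ^ j)) ?expn_gt0 ?leq_exp2l //= -natr1 lerD //.
have p0 : 0 < (2 ^ j)%:R :> R by rewrite ltr0n expn_gt0.
apply: (@le_trans _ _ (\sum_(2 ^ j <= i < 2 ^ j.+1) (2 ^ j)%:R^-1)).
  apply: ler_sum_nat => i /andP[ji _].
  by rewrite lef_pV2 ?posrE ?ler_nat // ltr0n; apply: leq_trans ji; rewrite expn_gt0.
rewrite sumr_const_nat expnS mul2n -addnn addnK -[_ *+ _]mulr_natl.
by rewrite divff ?gt_eqF.
Qed.

(** Comparison with the telescoping series of [1/(d - 1) - 1/d]. *)
Lemma sum_inv_sq (R : realType) D M : (0 < D)%N ->
  \sum_(D.+1 <= d < M) d%:R^-1 ^+ 2 <= D%:R^-1 :> R.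
Proof.
move=> D0; case: (leqP M D.+1) => [MD|DM].
  by rewrite big_geq // invr_ge0.
have DM' : (D.+1 <= M)%N by exact: ltnW.
apply: (@le_trans _ _ (\sum_(D.+1 <= d < M) (- d%:R^-1 - - d.-1%:R^-1))).
  apply: ler_sum_nat => -[//|d] /andP[dD _] /=.
  have d0 : 0 < d%:R :> R by rewrite ltr0n; apply: leq_trans D0 _.
  rewrite -natr1; move: (d%:R : R) d0 => y y0.
  have -> : - (y + 1)^-1 - - y^-1 = ((y + 1) * y)^-1.
    by field; rewrite !gt_eqF //; lra.
  by rewrite exprVn lef_pV2 ?posrE ?exprn_gt0 ?mulr_gt0 //; nra.
have -> : \sum_(D.+1 <= d < M) (- d%:R^-1 - - d.-1%:R^-1) =
    \sum_(D <= d < M.-1) (- d.+1%:R^-1 - - d%:R^-1) :> R.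
  by rewrite -{1}(prednK (leq_ltn_trans _ DM)) // big_add1.
by rewrite telescope_sumr; [rewrite opprK gerDr oppr_le0 invr_ge0 | lia].
Qed.

Lemma sum_inv_sq_le2 (R : realType) n : \sum_(0 <= k < n) k.+1%:R^-1 ^+ 2 <= 2 :> R.
Proof.
case: n => [|n]; first by rewrite big_geq.
rewrite big_nat_recl // invr1 expr1n -[leRHS]/(1 + 1) lerD2l.
have := sum_inv_sq R n.+2 (ltn0Sn 0); rewrite invr1 big_add1 /= big_add1 /=.
by apply: le_trans.
Qed.

Lemma bounded_series_cvg (R : realType) (u : nat -> R) (M : R) :
  (forall k, 0 <= u k) -> (forall n, \sum_(0 <= k < n) u k <= M) -> cvgn (series u).
Proof.
move=> u0 uM; apply: nondecreasing_is_cvgn.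
  by apply: nondecreasing_series => n _ _; apply: u0.
by exists M => _ [n _ <-]; apply: uM.
Qed.

Lemma ratio_pow_cvg (R : realType) t :
  (fun k => (k.+2 ^ t)%:R / (k.+1 ^ t)%:R : R) @ \oo --> (1 : R).
Proof.
have -> : (fun k => (k.+2 ^ t)%:R / (k.+1 ^ t)%:R : R) =
    (fun k => (1 + harmonic k) ^+ t).
  apply/funext => k; rewrite !natrX -expr_div_n; congr (_ ^+ _).
  by rewrite -[k.+2%:R]natr1 mulrDl divff ?pnatr_eq0 // mul1r.
have h : (fun k => 1 + harmonic k : R) @ \oo --> (1 : R).
  have := cvgD (cvg_cst (1 : R)) (@cvg_harmonic R); rewrite addr0; exact.
elim: t => [|t IH].
  by under eq_fun do rewrite expr0; apply: cvg_cst.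
under eq_fun do rewrite exprS.
by have := cvgM h IH; rewrite mulr1; exact.
Qed.

(** Between [s k] and [s k.+1] an average of numbers between 0 and 1
    moves by at most [s k.+1 / s k - 1]. *)
Lemma subsequence_average (R : realType) (u : nat -> R) (s : nat -> nat) (l : R) :
  (forall n, 0 <= u n <= 1) -> (forall k, (0 < s k)%N) ->
  (forall k, (s k < s k.+1)%N) ->
  (fun k => (s k.+1)%:R / (s k)%:R : R) @ \oo --> (1 : R) ->
  (fun k => (s k)%:R^-1 * \sum_(0 <= n < s k) u n) @ \oo --> l ->
  (fun N => N%:R^-1 * \sum_(1 <= n < N.+1) u n) @ \oo --> l.
Proof.
move=> u01 s_gt0 s_incr ratio sub.
have s_mono m n : (m <= n)%N -> (s m <= s n)%N.
  move=> /subnKC <-; elim: (n - m)%N => [|k IH]; first by rewrite addn0.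
  by rewrite addnS; apply: leq_trans (ltnW (s_incr _)).
have s_large k : (k <= s k)%N.
  by elim: k => // k IH; apply: leq_ltn_trans (s_incr k).
have sum01 m n : (m <= n)%N -> 0 <= \sum_(m <= i < n) u i <= (n - m)%:R.
  move=> mn; apply/andP; split; first by apply: sumr_ge0 => i _; case/andP: (u01 i).
  rewrite -[leRHS]mulr1 mulr_natl -sumr_const_nat.
  by apply: ler_sum => i _; case/andP: (u01 i).
apply/cvgrPdist_lt => e e0.
have e3 : 0 < e / 3 by rewrite divr_gt0.
have [k1 _ hk1] := (cvgrPdist_lt _ _).1 ratio _ e3.
have [k2 _ hk2] := (cvgrPdist_lt _ _).1 sub _ e3.
have [k3 _ hk3] := (cvgrPdist_lt _ _).1 (@cvg_harmonic R) _ e3.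
pose k0 := maxn k1 k2.
exists (maxn (s k0) k3.+1) => // N /=; rewrite geq_max => /andP[N0 N3].
have [k [kk0 kN Nk]] : exists k, [/\ (k0 <= k)%N, (s k <= N)%N & (N < s k.+1)%N].
  have exN : exists k, (s k <= N)%N by exists k0.
  have bN k : (s k <= N)%N -> (k <= N)%N by apply: leq_trans.
  have [k kN kmax] := ex_maxnP exN bN.
  exists k; split=> //; first exact: kmax.
  by rewrite ltnNge; apply/negP => /kmax; rewrite ltnn.
have NR : 0 < N%:R :> R by rewrite ltr0n; apply: leq_trans N3.
have sR : 0 < (s k)%:R :> R by rewrite ltr0n.
have h1 : `|1 - (s k.+1)%:R / (s k)%:R| < e / 3 :> R.
  by apply: hk1; apply: leq_trans kk0; rewrite leq_maxl.
have h2 : `|l - (s k)%:R^-1 * \sum_(0 <= n < s k) u n| < e / 3.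
  by apply: hk2; apply: leq_trans kk0; rewrite leq_maxr.
have h3 : N%:R^-1 < e / 3 :> R.
  have := hk3 N.-1; rewrite /= sub0r normrN ger0_norm ?harmonic_ge0 // /harmonic /=.
  have N_gt0 : (0 < N)%N by apply: leq_trans N3.
  by rewrite prednK //; apply; rewrite -ltnS prednK.
have -> : \sum_(1 <= n < N.+1) u n = \sum_(0 <= n < s k) u n +
    \sum_(s k <= n < N) u n + (u N - u 0).
  rewrite -big_cat_nat //= addrA -big_nat_recr //=.
  by rewrite [in RHS]big_ltn //; ring.
have := sum01 0 (s k) (leq0n _); have := sum01 _ _ kN.
have := u01 N; have := u01 0; rewrite subn0 natrB //.
have : (N%:R : R) <= (s k.+1)%:R by rewrite ler_nat ltnW.
have : ((s k)%:R : R) <= N%:R by rewrite ler_nat.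
move: (\sum_(0 <= n < s k) u n) (\sum_(s k <= n < N) u n) h2 => A B h2.
move: (u N) (u 0) => x y skN Nsk /andP[y0 y1] /andP[x0 x1] /andP[B0 B1] /andP[A0 A1].
have r1 : (s k.+1)%:R / (s k)%:R - 1 < e / 3 :> R.
  by apply: le_lt_trans h1; rewrite distrC ler_norm.
have r2 : `|(s k)%:R^-1 * A - N%:R^-1 * (A + B)| <= (s k.+1)%:R / (s k)%:R - 1.
  move: (N%:R : R) (s k)%:R (s k.+1)%:R NR sR skN Nsk B1 A1 => n p q n0 p0 pn nq B1 A1.
  have -> : p^-1 * A - n^-1 * (A + B) = (A * (n - p) - p * B) / (n * p).
    by field; rewrite !gt_eqF.
  have -> : q / p - 1 = (n * (q - p)) / (n * p) by field; rewrite !gt_eqF.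
  rewrite normrM [`|(n * p)^-1|]gtr0_norm ?invr_gt0 ?mulr_gt0 //.
  rewrite ler_wpM2r ?invr_ge0 ?(ltW (mulr_gt0 n0 p0)) //.
  have b1 : 0 <= A * (n - p) <= p * (n - p).
    by apply/andP; split; [apply: mulr_ge0; lra | apply: ler_wpM2r; lra].
  have b2 : 0 <= p * B <= p * (n - p).
    by apply/andP; split; [apply: mulr_ge0; lra | apply: ler_wpM2l; lra].
  have b3 : p * (n - p) <= n * (q - p) by apply: ler_pM; lra.
  by rewrite ler_norml; apply/andP; split; lra.
have r3 : `|N%:R^-1 * (x - y)| <= N%:R^-1.
  rewrite normrM gtr0_norm ?invr_gt0 // ler_piMr ?invr_ge0 ?(ltW NR) //.
  by rewrite ler_norml; apply/andP; split; lra.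
have -> : l - N%:R^-1 * (A + B + (x - y)) = (l - (s k)%:R^-1 * A) +
  ((s k)%:R^-1 * A - N%:R^-1 * (A + B)) - N%:R^-1 * (x - y) by ring.
apply: le_lt_trans (ler_normB _ _) _.
have := ler_normD (l - (s k)%:R^-1 * A) ((s k)%:R^-1 * A - N%:R^-1 * (A + B)).
by lra.
Qed.

Lemma Delta_partial_cvg (R : realType) (a b c : nat) : (0 < c)%N ->
  Delta_partial R a b c @ \oo --> Delta R a b c.
Proof.
move=> c0; pose t d : R := if (gcdn d.+1 c %| gcdn a b)%N then
  (moebius d.+1)%:~R / (d.+1 ^ 2)%:R * (gcdn d.+1 c ^ 2)%:R else 0.
have DE : Delta_partial R a b c = series t.
  by apply/funext => N; rewrite /Delta_partial big_mkcond big_add1.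
suff : cvgn (series t) by rewrite /Delta DE.
apply: normed_cvg.
apply: (@bounded_series_cvg _ (fun k => `|t k|) ((c ^ 2)%:R * 2)) => [k|n].
  exact: normr_ge0.
apply: (@le_trans _ _ (\sum_(0 <= k < n) (c ^ 2)%:R * k.+1%:R^-1 ^+ 2)); last first.
  by rewrite -mulr_sumr ler_wpM2l // sum_inv_sq_le2.
apply: ler_sum => k _; rewrite /t; case: ifP => _; last first.
  by rewrite normr0 mulr_ge0 ?sqr_ge0.
rewrite exprVn -natrX [leRHS]mulrC !normrM normfV !normr_nat.
apply: ler_pM; rewrite ?mulr_ge0 ?invr_ge0 //.
  by rewrite ler_piMl ?invr_ge0 // moebius_norm.
by rewrite ler_nat leq_exp2r // dvdn_leq // dvdn_gcdr.
Qed.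
(** * Histories of the walk and their expectations *)

Section Urn.
Variables (R : realType) (a0 b0 c : nat).
Hypotheses (a0_gt0 : (0 < a0)%N) (b0_gt0 : (0 < b0)%N) (c_gt0 : (0 < c)%N).

(** A history is the list of the steps made so far, the newest first, with
    [true] for a right-step. The bit that selects a step also selects the
    coordinate that it increases. *)
Definition start (x : bool) := if x then a0 else b0.
Definition coord (x : bool) (w : seq bool) := (start x + c * count_mem x w)%N.
Definition total (n : nat) := (a0 + b0 + c * n)%N.
Definition prob (x : bool) (w : seq bool) : R := (coord x w)%:R / (total (size w))%:R.

Lemma start_gt0 x : (0 < start x)%N. Proof. by case: x. Qed.
Lemma coord_gt0 x w : (0 < coord x w)%N.
Proof. by rewrite addn_gt0 start_gt0. Qed.
Lemma total_gt0 n : (0 < total n)%N.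
Proof. by rewrite /total -addnA addn_gt0 a0_gt0. Qed.

Lemma coord_total w : (coord true w + coord false w)%N = total (size w).
Proof.
rewrite /coord /total addnACA -mulnDr; congr (_ + _ * _)%N.
by elim: w => //= -[] w <- /=; lia.
Qed.

Lemma prob_gt0 x w : 0 < prob x w.
Proof. by rewrite divr_gt0 ?ltr0n ?coord_gt0 ?total_gt0. Qed.
Lemma prob_ge0 x w : 0 <= prob x w. Proof. exact/ltW/prob_gt0. Qed.

Lemma prob_sum w : prob true w + prob false w = 1.
Proof.
by rewrite -mulrDl -natrD coord_total divff // pnatr_eq0 -lt0n total_gt0.
Qed.

(** The conditional expectation of [h] of the history [n] steps later, given the
    history [v]. *)
Fixpoint mean (n : nat) (h : seq bool -> R) (v : seq bool) : R :=
  if n is m.+1 then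
    prob true v * mean m h (true :: v) + prob false v * mean m h (false :: v)
  else h v.

Lemma eq_mean n h g v : (forall w, size w = (size v + n)%N -> h w = g w) ->
  mean n h v = mean n g v.
Proof.
elim: n v => [|n IH] v hg /=; first by apply: hg; rewrite addn0.
by congr (_ * _ + _ * _); apply: IH => w /= sw; apply: hg; rewrite sw addSnnS.
Qed.

Lemma le_mean n h g v : (forall w, size w = (size v + n)%N -> h w <= g w) ->
  mean n h v <= mean n g v.
Proof.
elim: n v => [|n IH] v hg /=; first by apply: hg; rewrite addn0.
by apply: lerD; rewrite ler_wpM2l ?prob_ge0 //; apply: IH => w /= sw; apply: hg;
  rewrite sw addSnnS.
Qed.

Lemma mean_cst n k v : mean n (fun=> k) v = k.
Proof. by elim: n v => //= n IH v; rewrite !IH -mulrDl prob_sum mul1r. Qed.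

Lemma mean_ge0 n h v : (forall w, 0 <= h w) -> 0 <= mean n h v.
Proof. by move=> h0; rewrite -(mean_cst n 0 v); apply: le_mean. Qed.

Lemma meanD n h g v : mean n (fun w => h w + g w) v = mean n h v + mean n g v.
Proof. by elim: n v => //= n IH v; rewrite !IH; ring. Qed.

Lemma meanZ n k h v : mean n (fun w => k * h w) v = k * mean n h v.
Proof. by elim: n v => //= n IH v; rewrite !IH; ring. Qed.

Lemma mean_sum n (I : Type) (s : seq I) (F : I -> seq bool -> R) v :
  mean n (fun w => \sum_(i <- s) F i w) v = \sum_(i <- s) mean n (F i) v.
Proof.
elim: s => [|i s IH]; last rewrite big_cons -IH -meanD.
  by rewrite big_nil -[RHS](mean_cst n 0 v); apply: eq_mean => w _; rewrite big_nil.
by apply: eq_mean => w _; rewrite big_cons.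
Qed.

Lemma mean_split m n h v : mean (m + n) h v = mean m (mean n h) v.
Proof. by elim: m v => //= m IH v; rewrite !IH. Qed.

(** The one-step transition operator; a supermartingale is an [h] with
    [drift h <= h]. *)
Definition drift (h : seq bool -> R) (w : seq bool) : R :=
  prob true w * h (true :: w) + prob false w * h (false :: w).

Lemma meanS n h v : mean n.+1 h v = mean n (drift h) v.
Proof. by rewrite -addn1 mean_split. Qed.

Lemma supermartingale_mean h n v : (forall w, drift h w <= h w) ->
  mean n h v <= h v.
Proof.
move=> hs; elim: n => // n IH; rewrite meanS; apply: le_trans IH.
by apply: le_mean => w _.
Qed.

Definition upto (n : nat) (w : seq bool) := drop (size w - n) w.

Lemma upto_id w : upto (size w) w = w.
Proof. by rewrite /upto subnn drop0. Qed.

Lemma upto_cons n x w : (n <= size w)%N -> upto n (x :: w) = upto n w.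
Proof. by move=> nw; rewrite /upto /= subSn. Qed.

Lemma size_upto n w : (n <= size w)%N -> size (upto n w) = n.
Proof. by move=> nw; rewrite size_drop subKn. Qed.

Lemma mean_upto m n h : (m <= n)%N ->
  mean n (fun w => h (upto m w)) [::] = mean m h [::].
Proof.
move=> /subnKC <-; rewrite mean_split; apply: eq_mean => w.
rewrite add0n => sw.
have mw : (m <= size w)%N by rewrite sw.
have -> : h w = h (upto m w) by rewrite -sw upto_id.
elim: (n - m)%N w mw {sw} => //= k IH w mw.
by rewrite !IH /= ?leqW // !upto_cons // -mulrDl prob_sum mul1r.
Qed.

(** * Maximal inequality *)

Fixpoint exceeds (h : seq bool -> R) (t : R) (w : seq bool) : bool :=
  (t <= h w) || (if w is _ :: w' then exceeds h t w' else false).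

(** The process stopped when it first reaches [t] is still a supermartingale,
    and dominates [t] on the event. *)
Lemma maximal_inequality h t n : (forall w, 0 <= h w) ->
  (forall w, drift h w <= h w) ->
  mean n (fun w => t * (exceeds h t w)%:R) [::] <= h [::].
Proof.
move=> h0 hs.
pose stopped := fix stopped w : R := if w is _ :: w' then
  if exceeds h t w' then stopped w' else h w else h w.
have stE w : ~~ exceeds h t w -> stopped w = h w.
  case: w => [|x w] //=; rewrite negb_or => /andP[_ /negPf ->] //.
have st_super w : drift stopped w <= stopped w.
  rewrite /drift /=; case: ifPn => [_|/stE ->]; last exact: hs.
  by rewrite -mulrDl prob_sum mul1r.
apply: le_trans (supermartingale_mean n [::] st_super).
apply: le_mean => w _.
elim: w => [|x w IH] /=.
  by rewrite orbF; case: (boolP (t <= h [::])) => [tl|_]; rewrite ?mulr1 ?mulr0.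
case: ifPn => [ew|new]; first by rewrite ew orbT in IH *.
rewrite orbF.
by case: (boolP (t <= h (x :: w))) => [tl|_]; rewrite ?mulr1 ?mulr0.
Qed.

(** * Point probabilities *)

Lemma coord_cons x y w : coord x (y :: w) = (coord x w + c * (y == x))%N.
Proof. by rewrite /coord /= mulnDr; lia. Qed.

(** With [s = a + b], the function [1/a + 1/b = s/(a b)] solves the forward
    equation: the flow from [(a - c, b)] is
    [(a - c)/(s - c) * (s - c)/((a - c) b) = 1/b], the flow from [(a, b - c)]
    is [1/a]. Positions without a predecessor only lose a term. *)
Lemma point_mass n a b : (0 < a)%N -> (0 < b)%N ->
  mean n (fun w => ((coord true w == a) && (coord false w == b))%:R) [::] <=
  (a0 * b0)%:R * (a%:R^-1 + b%:R^-1).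
Proof.
elim: n a b => [|n IH] a b a_gt0 b_gt0.
  rewrite /= /coord /= muln0 !addn0.
  have [<-|_] /= := eqVneq; last by rewrite mulr_ge0 // addr_ge0.
  have [<-|_] /= := eqVneq; last by rewrite mulr_ge0 // addr_ge0.
  have -> : (a0 * b0)%:R * (a0%:R^-1 + b0%:R^-1) = (b0 + a0)%:R :> R.
    by rewrite natrM natrD; field; rewrite !pnatr_eq0 -!lt0n a0_gt0 b0_gt0.
  by rewrite ler1n addn_gt0 b0_gt0.
pose ind a b w : R := ((coord true w == a) && (coord false w == b))%:R.
rewrite meanS.
pose k (a b : nat) : R := a%:R / (a + b)%:R.
have drE w : drift (ind a b) w <=
    (c < a)%:R * k (a - c)%N b * ind (a - c)%N b w +
    (c < b)%:R * k (b - c)%N a * ind a (b - c)%N w.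
  rewrite /drift /ind !coord_cons /= !muln1 !muln0 !addn0; apply: lerD.
    have [/eqP e1|_] := boolP (coord true w + c == a)%N; last first.
      by rewrite /= mulr0 mulr_ge0 ?mulr_ge0.
    have -> : (a - c)%N = coord true w by lia.
    have -> : (c < a)%N by have := coord_gt0 true w; lia.
    rewrite eqxx /= mul1r.
    have [<-|] := eqVneq; last by rewrite !mulr0.
    by rewrite /k coord_total.
  rewrite andbC.
  have [/eqP e1|_] := boolP (coord false w + c == b)%N; last first.
    by rewrite /= mulr0 mulr_ge0 ?mulr_ge0.
  have -> : (b - c)%N = coord false w by lia.
  have -> : (c < b)%N by have := coord_gt0 false w; lia.
  rewrite eqxx andbT /= mul1r.
  have [<-|] := eqVneq; last by rewrite !mulr0.
  by rewrite /k addnC coord_total.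
apply: le_trans (le_mean (fun w _ => drE w)) _.
rewrite meanD !meanZ addrC mulrDr; apply: lerD.
  have [cb|_] := ltnP c b; last by rewrite !mul0r mulr_ge0.
  rewrite mul1r; apply: (@le_trans _ _
    (k (b - c)%N a * ((a0 * b0)%:R * (a%:R^-1 + (b - c)%:R^-1)))).
    by rewrite ler_wpM2l ?divr_ge0 // IH // subn_gt0.
  rewrite mulrCA ler_wpM2l // /k natrD.
  have h1 : (b - c)%:R != 0 :> R by rewrite pnatr_eq0 -lt0n subn_gt0.
  have h2 : (b - c)%:R + a%:R != 0 :> R by rewrite -natrD pnatr_eq0 -lt0n addn_gt0 a_gt0 orbT.
  have h3 : a%:R != 0 :> R by rewrite pnatr_eq0 -lt0n.
  by rewrite le_eqVlt; apply/orP; left; apply/eqP; field; rewrite h1 h2 h3.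
have [ca|_] := ltnP c a; last by rewrite !mul0r mulr_ge0.
rewrite mul1r; apply: (@le_trans _ _
  (k (a - c)%N b * ((a0 * b0)%:R * ((a - c)%:R^-1 + b%:R^-1)))).
  by rewrite ler_wpM2l ?divr_ge0 // IH // subn_gt0.
rewrite mulrCA ler_wpM2l // /k natrD.
have h1 : (a - c)%:R != 0 :> R by rewrite pnatr_eq0 -lt0n subn_gt0.
have h2 : (a - c)%:R + b%:R != 0 :> R by rewrite -natrD pnatr_eq0 -lt0n addn_gt0 b_gt0 orbT.
have h3 : b%:R != 0 :> R by rewrite pnatr_eq0 -lt0n.
by rewrite le_eqVlt; apply/orP; left; apply/eqP; field; rewrite h1 h2 h3.
Qed.

(** * The proportions stay away from 0 *)

(** A martingale: the first sum grows by [1/a] with probability [a/s], the second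
    one grows by [1/s]. *)
Definition lag (x : bool) (w : seq bool) : R :=
  \sum_(0 <= i < count_mem x w) (start x + c * i)%:R^-1 -
  \sum_(0 <= l < size w) (total l)%:R^-1.

(** The conditional variance of a step of [lag] is at most [1/(a s)], and this is
    paid for by the decrease of [2/a]. *)
Definition potential (x : bool) (w : seq bool) : R :=
  lag x w ^+ 2 + 2 / (coord x w)%:R.

Lemma driftE x h w :
  drift h w = prob x w * h (x :: w) + prob (~~ x) w * h (~~ x :: w).
Proof. by case: x => //; rewrite addrC. Qed.

Lemma potential_ge0 x w : 0 <= potential x w.
Proof. by rewrite addr_ge0 ?sqr_ge0 // divr_ge0. Qed.

Lemma drift_potential x w : drift (potential x) w <= potential x w.
Proof.
rewrite (driftE x).
have -> : prob (~~ x) w = 1 - prob x w.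
  by have := prob_sum w; case: x => /= ?; lra.
rewrite /potential !coord_cons eqxx muln1.
have -> : (~~ x == x) = false by case: x.
rewrite muln0 addn0.
have -> : lag x (~~ x :: w) = lag x w - (total (size w))%:R^-1.
  rewrite /lag /=; have -> : (~~ x == x) = false by case: x.
  by rewrite add0n big_nat_recr //=; ring.
have -> : lag x (x :: w) = lag x w + (coord x w)%:R^-1 - (total (size w))%:R^-1.
  by rewrite /lag /= eqxx add1n !big_nat_recr //=; rewrite /coord; ring.
rewrite /prob natrD.
have A1 : 1 <= (coord x w)%:R :> R by rewrite ler1n coord_gt0.
have s0 : 0 < (total (size w))%:R :> R by rewrite ltr0n total_gt0.
have c1 : 1 <= c%:R :> R by rewrite ler1n.
move: (lag x w) (coord x w)%:R (total (size w))%:R c%:R A1 s0 c1 => D A s k A1 s0 k1.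
have A0 : 0 < A by lra.
have Ak0 : 0 < A + k by lra.
have -> : A / s * ((D + A^-1 - s^-1) ^+ 2 + 2 / (A + k)) +
    (1 - A / s) * ((D - s^-1) ^+ 2 + 2 / A) =
    (D ^+ 2 + 2 / A) - s^-1 ^+ 2 - (2 * A * k - (A + k)) / (A * s * (A + k)).
  by field; rewrite !gt_eqF.
have : 0 <= (2 * A * k - (A + k)) / (A * s * (A + k)).
  by rewrite divr_ge0 ?mulr_ge0 ?(ltW A0) ?(ltW s0) ?(ltW Ak0) //; nra.
by have := sqr_ge0 s^-1; lra.
Qed.

Lemma ln_le_sum (b n : nat) : (0 < b)%N ->
  ln (b + c * n)%:R <= ln b%:R + c%:R * \sum_(0 <= l < n) (b + c * l)%:R^-1 :> R.
Proof.
move=> b_gt0; elim: n => [|n IH]; first by rewrite muln0 addn0 big_geq // mulr0 addr0.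
have h0 : 0 < (b + c * n)%:R :> R by rewrite ltr0n addn_gt0 b_gt0.
rewrite big_nat_recr //= mulrDr addrA.
have -> : (b + c * n.+1)%:R = (b + c * n)%:R * (1 + c%:R / (b + c * n)%:R) :> R.
  rewrite mulrDr mulr1 mulrCA divff ?gt_eqF // mulr1 -natrD; congr _%:R; lia.
have h1 : 0 <= c%:R / (b + c * n)%:R :> R by rewrite divr_ge0.
rewrite lnM ?posrE ?ltr_wpDr //.
by apply: lerD => //; apply: le_ln1Dx; apply: lt_le_trans h1; rewrite ltrN10.
Qed.

Lemma sum_le_ln (b n : nat) : (0 < b)%N ->
  c%:R * \sum_(0 <= l < n) (b + c * l)%:R^-1 <=
  c%:R / b%:R + ln (b + c * n)%:R - ln b%:R :> R.
Proof.
move=> b_gt0.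
apply: (@le_trans _ _ (c%:R * \sum_(0 <= l < n.+1) (b + c * l)%:R^-1)).
  by rewrite ler_wpM2l // big_nat_recr //= lerDl invr_ge0.
elim: n => [|n IH].
  by rewrite big_nat1 muln0 addn0 addrK.
have h0 : 0 < (b + c * n)%:R :> R by rewrite ltr0n addn_gt0 b_gt0.
have h1 : 0 < (b + c * n.+1)%:R :> R by rewrite ltr0n addn_gt0 b_gt0.
rewrite big_nat_recr //= mulrDr.
suff h : c%:R / (b + c * n.+1)%:R <= ln (b + c * n.+1)%:R - ln (b + c * n)%:R :> R.
  have chain (x y z u v l : R) :
    x <= y + u - l -> z <= v - u -> x + z <= y + v - l by lra.
  exact: chain IH h.
have cE : c%:R = (b + c * n.+1)%:R - (b + c * n)%:R :> R.
  by apply/eqP; rewrite eq_sym subr_eq -natrD; apply/eqP; congr _%:R; lia.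
rewrite cE mulrBl divff ?gt_eqF // -ln_div ?posrE //.
set y := _ / _.
have y0 : 0 < y by rewrite divr_gt0.
have -> : (b + c * n.+1)%:R / (b + c * n)%:R = y^-1 by rewrite invf_div.
rewrite lnV ?posrE // lerNr opprB.
have := @le_ln1Dx R (y - 1); rewrite addrCA subrr addr0; apply.
by rewrite ltrBrDr addrC subrr.
Qed.

(** A bounded [lag] says that the two harmonic-like sums differ by a constant.
    They are [ln (total n) / c] and [ln (coord x w) / c] up to constants, so the
    total is at most a constant times the coordinate. *)
Lemma coord_lower_bound x (t : R) : {k : R | 0 < k &
  forall w, potential x w <= t -> (total (size w))%:R <= k * (coord x w)%:R}.
Proof.
exists (expR (ln (total 0)%:R + c%:R * (t + 1) + c%:R / (start x)%:R - ln (start x)%:R)).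
  exact: expR_gt0.
move=> w wt.
have A0 : 0 < (coord x w)%:R :> R by rewrite ltr0n coord_gt0.
have s0 : 0 < (total (size w))%:R :> R by rewrite ltr0n total_gt0.
(* From [lag ^+ 2 <= t]; the bound [t + 1] spares a square root. *)
have lagt : - lag x w <= t + 1.
  have : lag x w ^+ 2 <= t.
    by apply: le_trans wt; rewrite lerDl divr_ge0.
  by have := sqr_ge0 (lag x w + 1); nra.
have h1 := @ln_le_sum (total 0) (size w) (total_gt0 0).
have h2 := @sum_le_ln (start x) (count_mem x w) (start_gt0 x).
have e1 : (total 0 + c * size w)%N = total (size w) by rewrite /total; lia.
have e2 : \sum_(0 <= l < size w) (total 0 + c * l)%:R^-1 =
   \sum_(0 <= l < size w) (total l)%:R^-1 :> R.
  by apply: eq_bigr => l _; rewrite /total muln0 addn0.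
rewrite e1 e2 in h1; rewrite -/(coord x w) in h2.
have h3 : c%:R * (- lag x w) <= c%:R * (t + 1) by rewrite ler_wpM2l.
rewrite /lag in h3.
rewrite -[X in X <= _]lnK ?posrE // -[X in _ * X]lnK ?posrE // -expRD ler_expR.
by lra.
Qed.

(** * Equidistribution of the step counts in a short block *)

Definition residue e (w : seq bool) : 'I_e.+1 * 'I_e.+1 :=
  (inZp (count_mem true w), inZp (count_mem false w)).

Lemma inZp_sub1 e k (i : 'I_e.+1) : (inZp k.+1 == i) = (inZp k == i - inZp 1).
Proof.
have -> : inZp k.+1 = inZp k + inZp 1 :> 'I_e.+1.
  by apply: val_inj; rewrite /= modnDm addn1.
by rewrite eq_sym -subr_eq eq_sym.
Qed.

Lemma residue_right e w x : (residue e (true :: w) == x) = (residue e w == back_right x).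
Proof. by case: x => i j; rewrite !xpair_eqE /= add1n add0n inZp_sub1. Qed.

Lemma residue_up e w x : (residue e (false :: w) == x) = (residue e w == back_up x).
Proof. by case: x => i j; rewrite !xpair_eqE /= add1n add0n inZp_sub1. Qed.

(** The increments of the martingale part of [f] in its Doob decomposition. *)
Definition noise (f : seq bool -> R) (w : seq bool) : R :=
  if w is _ :: w' then f w - drift f w' else 0.

(** Martingale increments are orthogonal, so their variances add. *)
Lemma noise_variance f m L : (forall w, 0 <= f w <= 1) ->
  mean (m + L) (fun w => (\sum_(m <= n < m + L) noise f (upto n.+1 w)) ^+ 2) [::]
    <= L%:R.
Proof.
move=> f01; elim: L => [|L IH].
  rewrite addn0 -[leRHS](mean_cst m _ [::]); apply: le_mean => w _.
  by rewrite big_geq // expr0n.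
rewrite addnS meanS -natr1.
pose M w := \sum_(m <= n < m + L) noise f (upto n.+1 w).
apply: (@le_trans _ _ (mean (m + L) (fun w => M w ^+ 2 + 1) [::])); last first.
  by rewrite meanD mean_cst lerD2r.
apply: le_mean => w; rewrite add0n => sw.
have step x : \sum_(m <= n < (m + L).+1) noise f (upto n.+1 (x :: w)) =
    M w + noise f (x :: w).
  rewrite big_nat_recr ?leq_addr //= {2}/upto /= sw subnn drop0; congr (_ + _).
  by apply: eq_big_nat => n /andP[_ nL]; rewrite upto_cons // sw.
rewrite {1}/drift !step /= /drift.
have := f01 (true :: w); have := f01 (false :: w).
have := prob_sum w; have := prob_ge0 true w; have := prob_ge0 false w.
move: (M w) (prob true w) (prob false w) (f (true :: w)) (f (false :: w)).
move=> k p q A B q0 p0 pq /andP[B0 B1] /andP[A0 A1].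
have -> : p = 1 - q by lra.
have -> : (1 - q) * (k + (A - ((1 - q) * A + q * B))) ^+ 2 +
   q * (k + (B - ((1 - q) * A + q * B))) ^+ 2 =
   k ^+ 2 + q * (1 - q) * (A - B) ^+ 2 by ring.
rewrite lerD2l.
have h1 : (A - B) ^+ 2 <= 1 by nra.
have h2 : 0 <= q * (1 - q) <= 1 by nra.
by case/andP: h2 => h2 h3; rewrite mulr_ile1 // sqr_ge0.
Qed.

Lemma count_upto x m n w : (m <= n)%N -> (n <= size w)%N ->
  (count_mem x (upto m w) <= count_mem x (upto n w)
     <= count_mem x (upto m w) + (n - m))%N.
Proof.
move=> mn nw.
have -> : upto m w = drop (n - m) (upto n w).
  by rewrite /upto drop_drop; congr drop; lia.
rewrite -[in X in (_ <= X <= _)%N](cat_take_drop (n - m) (upto n w)) count_cat.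
rewrite leq_addl addnC leq_add2l.
by apply: leq_trans (count_size _ _) _; rewrite size_take size_upto //; case: ifP; lia.
Qed.

(** In [n - m] steps the numerator and the denominator of the proportion grow by
    at most [c (n - m)]. *)
Lemma prob_upto m n w : (m <= n)%N -> (n <= size w)%N ->
  `|prob true (upto n w) - prob true (upto m w)| <= (c * (n - m))%:R / (total m)%:R.
Proof.
move=> mn nw; have mw := leq_trans mn nw.
have /andP[le1 le2] := count_upto true mn nw.
rewrite /prob !size_upto //.
have s0 : 0 < (total m)%:R :> R by rewrite ltr0n total_gt0.
have aE : coord true (upto n w) = (coord true (upto m w) +
    c * (count_mem true (upto n w) - count_mem true (upto m w)))%N.
  by rewrite /coord -addnA -mulnDr subnKC.
set k := (_ - _)%N in aE.
have kl : (k <= n - m)%N by rewrite leq_subLR.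
have sE : total n = (total m + c * (n - m))%N by rewrite /total -[RHS]addnA -mulnDr subnKC.
have as_ : (coord true (upto m w) <= total m)%N.
  by have := coord_total (upto m w); rewrite size_upto //; lia.
rewrite aE sE (natrD _ (coord true (upto m w))) (natrD _ (total m)).
have d0 : 0 <= (c * k)%:R :> R by [].
have dl : (c * k)%:R <= (c * (n - m))%:R :> R by rewrite ler_nat leq_mul2l kl orbT.
have p0 : 0 <= (coord true (upto m w))%:R :> R by [].
have p1 : (coord true (upto m w))%:R <= (total m)%:R :> R by rewrite ler_nat.
move: (c * k)%:R (c * (n - m))%:R (coord true (upto m w))%:R (total m)%:R s0 d0 dl p0 p1.
move=> d l a s s0 d0 dl p0 as1.
have sl0 : 0 < s + l by lra.
have -> : (a + d) / (s + l) - a / s = (d * s - a * l) / (s + l) / s.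
  by field; rewrite !gt_eqF.
rewrite normrM [`|s^-1|]gtr0_norm ?invr_gt0 // ler_wpM2r ?invr_ge0 ?(ltW s0) //.
rewrite normrM [`|(s + l)^-1|]gtr0_norm ?invr_gt0 // ler_pdivrMr //.
by rewrite ler_norml; apply/andP; split; nra.
Qed.

Section Block.
Variables (e m L : nat).
Hypothesis L_gt0 : (0 < L)%N.

Definition occupation (w : seq bool) (x : 'I_e.+1 * 'I_e.+1) : R :=
  L%:R^-1 * \sum_(m <= n < m + L) (residue e (upto n w) == x)%:R.

Definition defect (w : seq bool) (x : 'I_e.+1 * 'I_e.+1) : R :=
  occupation w x - prob true (upto m w) * occupation w (back_right x)
    - prob false (upto m w) * occupation w (back_up x).

Lemma occupation_ge0 w x : 0 <= occupation w x.
Proof. by rewrite mulr_ge0 ?invr_ge0 // sumr_ge0. Qed.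

Lemma sum_occupation w : \sum_x occupation w x = 1.
Proof.
rewrite -mulr_sumr exchange_big /=.
have one n : \sum_x (residue e (upto n w) == x)%:R = 1 :> R.
  rewrite (bigD1 (residue e (upto n w))) //= eqxx big1 ?addr0 // => x xw.
  by rewrite eq_sym (negPf xw).
under eq_bigr do rewrite one.
by rewrite sumr_const_nat addKn mulVf ?pnatr_eq0 -?lt0n.
Qed.

(** The sum of the defect over the block splits into a telescoping sum, the
    martingale noise, and the error made by freezing the step probabilities at
    the beginning of the block. *)
Lemma defect_bound w x : size w = (m + L)%N ->
  (L%:R * defect w x) ^+ 2 <=
  3 * (1 + (\sum_(m <= n < m + L)
              noise (fun v => (residue e v == x)%:R) (upto n.+1 w)) ^+ 2 +
       (L%:R * ((c * L)%:R / (total m)%:R)) ^+ 2).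
Proof.
move=> sw; pose phi v : R := (residue e v == x)%:R.
pose right v : R := (residue e v == back_right x)%:R.
pose up v : R := (residue e v == back_up x)%:R.
pose dp n := prob true (upto n w) - prob true (upto m w).
have L0 : L%:R != 0 :> R by rewrite pnatr_eq0 -lt0n.
have e1 : L%:R * defect w x = (phi (upto m w) - phi (upto (m + L) w)) +
    \sum_(m <= n < m + L) noise phi (upto n.+1 w) +
    \sum_(m <= n < m + L) dp n * (right (upto n w) - up (upto n w)).
  have -> : phi (upto m w) - phi (upto (m + L) w) =
      \sum_(m <= n < m + L) (phi (upto n w) - phi (upto n.+1 w)).
    by rewrite -[RHS]opprK -sumrN; under eq_bigr do rewrite opprB;
      rewrite telescope_sumr ?leq_addr // opprB.
  have occE y : L%:R * occupation w y =
      \sum_(m <= n < m + L) (residue e (upto n w) == y)%:R by rewrite mulVKf.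
  rewrite /defect !mulrBr ![L%:R * (prob _ _ * _)]mulrCA !occE.
  rewrite !mulr_sumr -!sumrB -!big_split /=.
  apply: eq_big_nat => n /andP[mn nL].
  have nw : (n < size w)%N by rewrite sw.
  have [y yE] : exists y, upto n.+1 w = y :: upto n w.
    have -> : upto n w = drop 1 (upto n.+1 w).
      by rewrite /upto drop_drop; congr drop; lia.
    have : size (upto n.+1 w) = n.+1 by rewrite size_upto.
    by case: (upto n.+1 w) => // y v _; exists y; rewrite drop1.
  rewrite yE /= /drift /phi residue_right residue_up -/(right _) -/(up _) /dp.
  have := prob_sum (upto n w); have := prob_sum (upto m w).
  move: (prob false (upto n w)) (prob false (upto m w)) => q1 q2.
  move: (prob true (upto n w)) (prob true (upto m w)) => p1 p2 h2 h1.
  have -> : q1 = 1 - p1 by lra.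
  have -> : q2 = 1 - p2 by lra.
  by ring.
rewrite e1.
set u1 := _ - phi _; set u2 := \sum_(_ <= n < _) noise _ _.
set u3 := \sum_(_ <= _ < _) dp _ * _.
have b1 : u1 ^+ 2 <= 1.
  rewrite /u1 /phi; do 2 case: (_ == x);
    by rewrite ?subrr ?subr0 ?sub0r ?sqrrN ?expr0n ?expr1n.
have b3 : u3 ^+ 2 <= (L%:R * ((c * L)%:R / (total m)%:R)) ^+ 2.
  have bn : `|u3| <= L%:R * ((c * L)%:R / (total m)%:R).
    apply: le_trans (ler_norm_sum _ _ _) _.
    apply: (@le_trans _ _ (\sum_(m <= n < m + L) (c * L)%:R / (total m)%:R)).
      apply: ler_sum_nat => n /andP[mn nL].
      rewrite normrM -[leRHS]mulr1; apply: ler_pM => //.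
        apply: le_trans (prob_upto mn _) _; first by rewrite sw ltnW.
        rewrite ler_wpM2r ?invr_ge0 // ler_nat leq_mul2l; apply/orP; right; lia.
      rewrite /right /up; do 2 case: (_ == _);
        by rewrite ?subrr ?subr0 ?sub0r ?normrN ?normr0 ?normr1.
    by rewrite sumr_const_nat addKn [L%:R * _]mulr_natl.
  rewrite -[u3 ^+ 2]real_normK ?num_real //.
  by rewrite lerXn2r // nnegrE (le_trans _ bn).
have := sqr_ge0 (u1 - u2); have := sqr_ge0 (u1 - u3); have := sqr_ge0 (u2 - u3).
by move: ((L%:R * _) ^+ 2) b3 => U b3; nra.
Qed.

Lemma mean_defect x :
  mean (m + L) (fun w => defect w x ^+ 2) [::] <=
    6 / L%:R + 3 * ((c * L)%:R / (total m)%:R) ^+ 2.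
Proof.
have L0 : 0 < L%:R :> R by rewrite ltr0n.
have L1 : 1 <= L%:R :> R by rewrite ler1n.
set k := (c * L)%:R / (total m)%:R.
pose M w := \sum_(m <= n < m + L) noise (fun v => (residue e v == x)%:R) (upto n.+1 w).
have hM : mean (m + L) (fun w => M w ^+ 2) [::] <= L%:R.
  by apply: noise_variance => w; case: (_ == x); rewrite /= ?lexx ler01.
have : mean (m + L) (fun w => L%:R ^+ 2 * defect w x ^+ 2) [::] <=
    3 * (1 + L%:R + (L%:R * k) ^+ 2).
  apply: le_trans (le_mean (g := fun w => 3 * (1 + M w ^+ 2 + (L%:R * k) ^+ 2)) _) _.
    by move=> w; rewrite add0n => sw; rewrite -exprMn; apply: defect_bound.
  by rewrite meanZ !meanD !mean_cst ler_wpM2l // lerD2r lerD2l.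
rewrite meanZ mulrC -ler_pdivlMr ?exprn_gt0 // => /le_trans; apply.
have -> : 3 * (1 + L%:R + (L%:R * k) ^+ 2) / L%:R ^+ 2 =
   (3 + 3 * L%:R) / L%:R / L%:R + 3 * k ^+ 2 by field; rewrite gt_eqF.
rewrite lerD2r ler_pM2r ?invr_gt0 // ler_pdivrMr //.
by lra.
Qed.
End Block.

(** The length of a block is the square root of the time, up to a constant: long
    enough for the noise [1/L] to be small, short enough for the drift of the
    proportions, [L] over the time, to be small. *)
Definition block_start b := (b ^ 2)%N.
Definition block_len b := (2 * b).+1.

Lemma block_end b : (block_start b + block_len b)%N = block_start b.+1.
Proof. by rewrite /block_start /block_len; lia. Qed.

Lemma mean_block_defect e b x :
  mean (block_start b.+1)
    (fun w => defect (block_start b) (block_len b) w (x : 'I_e.+1 * 'I_e.+1) ^+ 2) [::] <=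
    114 * c%:R ^+ 2 / b.+1%:R.
Proof.
rewrite -block_end; apply: le_trans (mean_defect _ _ _) _ => //.
have B0 : 0 < b.+1%:R :> R by rewrite ltr0n.
have B1 : 1 <= b.+1%:R :> R by rewrite ler1n.
have c1 : 1 <= c%:R :> R by rewrite ler1n.
have h1 : 6 / (block_len b)%:R <= 6 / b.+1%:R :> R.
  by rewrite ler_pM2l // lef_pV2 ?posrE ?ltr0n // ler_nat /block_len; lia.
have h2 : (c * block_len b)%:R / (total (block_start b))%:R <= 6 * c%:R / b.+1%:R :> R.
  rewrite ler_pdivrMr ?ltr0n ?total_gt0 // mulrAC ler_pdivlMr //.
  rewrite -[6]/(6%:R) -!natrM ler_nat /block_len /total /block_start.
  rewrite -mulnA [(6 * c)%N]mulnC -mulnA leq_mul2l; apply/orP; right.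
  have : (b ^ 2 <= c * b ^ 2)%N by rewrite leq_pmull.
  by move: (c * b ^ 2)%N => z hz; nia.
have h3 : ((c * block_len b)%:R / (total (block_start b))%:R) ^+ 2 <=
    36 * c%:R ^+ 2 / b.+1%:R :> R.
  apply: (@le_trans _ _ ((6 * c%:R / b.+1%:R) ^+ 2)).
    by rewrite lerXn2r // nnegrE ?divr_ge0 ?mulr_ge0.
  rewrite expr_div_n exprMn (_ : 6 ^+ 2 = 36) ?ler_wpM2l ?mulr_ge0 ?sqr_ge0 //; last first.
    by rewrite -natrX.
  by rewrite lef_pV2 ?posrE ?exprn_gt0 // expr2 ler_peMl.
apply: le_trans (lerD h1 (ler_wpM2l (ler0n _ 3) h3)) _.
rewrite mulrA -mulrDl ler_pM2r ?invr_gt0 //.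
by nra.
Qed.

(** * Bounds in mean for large and for small divisors *)

Definition common (d : nat) (w : seq bool) : bool :=
  ((d %| coord true w) && (d %| coord false w))%N.

(** The sum of the two coordinates is deterministic, so only the positions
    [(d i, total n - d i)] contribute; [point_mass] bounds their probabilities
    by two harmonic sums, each at most [j], divided by [d]. *)
Lemma mean_common d n j : (0 < d)%N -> (total n < 2 ^ j)%N ->
  mean n (fun w => (common d w)%:R) [::] <=
    (d %| total n)%:R * ((2 * a0 * b0 * j)%:R / d%:R).
Proof.
move=> d0 nj; pose S := (total n %/ d)%N.
have dR : 0 < d%:R :> R by rewrite ltr0n.
pose ind i w : R := ((coord true w == d * i) && (coord false w == d * (S - i)))%N%:R.
have pt w : size w = n -> (common d w)%:R <=
    (d %| total n)%:R * \sum_(1 <= i < S) ind i w :> R.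
  move=> sw; rewrite /common; case: andP => [[/dvdnP[i iE] /dvdnP[l lE]]|_]; last first.
    by rewrite mulr_ge0 // sumr_ge0.
  have tE : total n = ((i + l) * d)%N by rewrite -sw -coord_total iE lE mulnDl.
  have SE : S = (i + l)%N by rewrite /S tE mulnK.
  have i0 : (0 < i)%N by have := coord_gt0 true w; rewrite iE muln_gt0 => /andP[].
  have l0 : (0 < l)%N by have := coord_gt0 false w; rewrite lE muln_gt0 => /andP[].
  rewrite tE dvdn_mull // mul1r (bigD1_seq i) /= ?iota_uniq //; last first.
    by rewrite mem_index_iota i0 SE; lia.
  by rewrite /ind iE lE SE addKn ![(d * _)%N]mulnC !eqxx lerDl sumr_ge0.
apply: le_trans (le_mean (g := fun w => (d %| total n)%:R * \sum_(1 <= i < S) ind i w) _) _.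
  by move=> w; rewrite add0n; apply: pt.
rewrite meanZ mean_sum ler_wpM2l //.
apply: (@le_trans _ _ (\sum_(1 <= i < S)
    (a0 * b0)%:R * ((d * i)%:R^-1 + (d * (S - i))%:R^-1))).
  apply: ler_sum_nat => i /andP[i1 iS].
  by apply: point_mass; rewrite muln_gt0 d0 //= subn_gt0.
rewrite -mulr_sumr big_split /= [X in _ + X]big_nat_rev /=.
have -> : \sum_(1 <= i < S) (d * (S - (1 + S - i.+1)))%:R^-1 =
   \sum_(1 <= i < S) (d * i)%:R^-1 :> R.
  by apply: eq_big_nat => i /andP[i1 iS]; congr (_ %:R^-1); congr muln; lia.
have h : \sum_(1 <= i < S) (d * i)%:R^-1 <= j%:R / d%:R :> R.
  under eq_bigr do rewrite natrM invfM.
  rewrite -mulr_sumr mulrC ler_wpM2r ?invr_ge0 //.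
  apply: le_trans (harmonic_dyadic R j).
  have S2 : (S <= 2 ^ j)%N.
    by apply: leq_trans (ltnW nj); rewrite /S leq_div.
  case: (posnP S) => [->|S0].
    by rewrite big_geq // sumr_ge0.
  by rewrite [leRHS](@big_cat_nat _ _ _ S) //= lerDl sumr_ge0.
apply: le_trans (ler_wpM2l _ (lerD h h)) _ => //.
rewrite le_eqVlt; apply/orP; left; apply/eqP.
by rewrite !natrM; ring.
Qed.

Lemma count_dvd_total d N : (0 < d)%N ->
  \sum_(0 <= n < N) (d %| total n)%:R <= (total N)%:R / d%:R :> R.
Proof.
move=> d0; have : (\sum_(0 <= n < N) (d %| total n) <= (total N).-1 %/ d)%N.
  elim: N => [|N IH]; first by rewrite big_geq.
  rewrite big_nat_recr //=; apply: leq_trans (leq_add IH (leqnn _)) _.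
  apply: (@leq_trans (total N %/ d)); last first.
    by apply: leq_div2r; rewrite /total; lia.
  have := total_gt0 N; case: (total N) => // m _ /=.
  by rewrite divnS // addnC.
move=> h; apply: (@le_trans _ _ (((total N).-1 %/ d)%N%:R)).
  by rewrite -natr_sum ler_nat.
rewrite ler_pdivlMr ?ltr0n // -natrM ler_nat.
by apply: leq_trans (leq_divM _ _) (leq_pred _).
Qed.

Definition tail_error N D (w : seq bool) : R := N%:R^-1 *
  \sum_(0 <= n < N) \sum_(D.+1 <= d < (total N).+1) (common d (upto n w))%:R.

Lemma tail_error_ge0 N D w : 0 <= tail_error N D w.
Proof.
by rewrite mulr_ge0 ?invr_ge0 // sumr_ge0 // => n _; rewrite sumr_ge0.
Qed.

(** A common divisor at time [n] divides [total n], which happens for a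
    proportion [1/d] of the times only; with the factor [1/d] of [mean_common]
    the sum over [d > D] is of order [1/D]. *)
Lemma mean_tail_error N D j : (0 < N)%N -> (0 < D)%N -> (total N < 2 ^ j)%N ->
  mean N (tail_error N D) [::] <= (2 * a0 * b0 * j * (a0 + b0 + c))%:R / D%:R.
Proof.
move=> N_gt0 D_gt0 Mj; set M := total N; pose s := (a0 + b0 + c)%N.
have N0 : 0 < N%:R :> R by rewrite ltr0n.
have D0 : 0 < D%:R :> R by rewrite ltr0n.
have MN : (M <= s * N)%N.
  by rewrite /M /total /s mulnDl leq_add2r leq_pmulr.
rewrite /tail_error meanZ mean_sum.
under eq_bigr do rewrite mean_sum.
rewrite exchange_big_nat.
pose K : R := (2 * a0 * b0 * j)%:R.
have step d : (D.+1 <= d)%N ->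
   \sum_(0 <= n < N) mean N (fun w => (common d (upto n w))%:R) [::] <=
   K * (s * N)%:R * d%:R^-1 ^+ 2.
  move=> Dd; have d0 : (0 < d)%N by apply: leq_trans Dd.
  apply: (@le_trans _ _ (\sum_(0 <= n < N) (d %| total n)%:R * (K / d%:R))).
    apply: ler_sum_nat => n /andP[_ nN].
    rewrite (mean_upto (fun w => (common d w)%:R)) ?(ltnW nN) //.
    apply: mean_common => //; apply: leq_ltn_trans Mj.
    by rewrite /total leq_add2l leq_mul2l ltnW ?orbT.
  rewrite -mulr_suml.
  apply: le_trans (ler_wpM2r _ (count_dvd_total N d0)) _; first by rewrite divr_ge0.
  have -> : M%:R / d%:R * (K / d%:R) = K * M%:R * d%:R^-1 ^+ 2 by ring.
  by rewrite ler_wpM2r ?sqr_ge0 // ler_wpM2l // ler_nat.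
apply: (@le_trans _ _ (N%:R^-1 *
    \sum_(D.+1 <= d < M.+1) K * (s * N)%:R * d%:R^-1 ^+ 2)).
  rewrite ler_wpM2l ?invr_ge0 //; apply: ler_sum_nat => d /andP[Dd _].
  exact: step.
rewrite -mulr_sumr [(s * N)%:R]natrM.
have KN0 : 0 <= K * (s%:R * N%:R) by rewrite !mulr_ge0.
apply: le_trans (ler_wpM2l _ (ler_wpM2l KN0 (sum_inv_sq R M.+1 D_gt0))) _.
  by rewrite invr_ge0.
have -> : N%:R^-1 * (K * (s%:R * N%:R) / D%:R) = K * s%:R / D%:R.
  by field; rewrite !gt_eqF.
by rewrite /K -natrM.
Qed.

(** The period in [k] of divisibility of [a + c k] by [d]. *)
Definition period d := (d %/ gcdn d c)%N.

Lemma period_gt0 d : (0 < d)%N -> (0 < period d)%N.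
Proof. by move=> d0; rewrite divn_gt0 ?gcdn_gt0 ?d0 // dvdn_leq ?dvdn_gcdl. Qed.

Definition block_error d b (w : seq bool) : R :=
  \sum_(x : 'I_(period d).-1.+1 * 'I_(period d).-1.+1)
    defect (block_start b) (block_len b) (upto (block_start b.+1) w) x ^+ 2.

Lemma block_start_le b b' : (b <= b')%N -> (block_start b <= block_start b')%N.
Proof. by move=> bb; rewrite leq_exp2r. Qed.

(** The right-hand side of [torus_equidistribution], averaged over the blocks and
    summed over [d]. The factor [D ^+ 6] is the one of [le_fourth] for the
    threshold [D ^- 2]. *)
Definition main_error B D (w : seq bool) : R := D%:R ^+ 6 *
  \sum_(1 <= d < D.+1) \sum_(0 <= b < B)
    (block_len b)%:R / (block_start B)%:R *
      (1024 * (period d)%:R ^+ 4 * block_error d b w).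

Lemma main_error_ge0 B D w : 0 <= main_error B D w.
Proof.
apply: mulr_ge0; first by rewrite exprn_ge0.
apply: sumr_ge0 => i _; apply: sumr_ge0 => b _.
apply: mulr_ge0; first by rewrite divr_ge0.
apply: mulr_ge0; first by apply: mulr_ge0; [exact: (ler0n R 1024) | rewrite exprn_ge0].
by apply: sumr_ge0 => x _; rewrite sqr_ge0.
Qed.

Lemma mean_main_error B D : (0 < B)%N ->
  mean (block_start B) (main_error B D) [::] <=
    2 * 1024 * 114 * c%:R ^+ 2 * D%:R ^+ 13 / B%:R.
Proof.
move=> B_gt0; set N := block_start B.
have B0 : 0 < B%:R :> R by rewrite ltr0n.
have N0 : 0 < N%:R :> R by rewrite ltr0n expn_gt0 B_gt0.
rewrite /main_error meanZ mean_sum.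
have step d b : (1 <= d < D.+1)%N -> (b < B)%N ->
    mean N (fun w => (block_len b)%:R / N%:R *
      (1024 * (period d)%:R ^+ 4 * block_error d b w)) [::] <=
    2 * 1024 * 114 * c%:R ^+ 2 * D%:R ^+ 6 / N%:R.
  case/andP=> d0 dD bB; have e0 := period_gt0 d0.
  have eD : (period d <= D)%N by rewrite -ltnS; apply: leq_ltn_trans dD; rewrite /period leq_div.
  rewrite !meanZ (mean_upto (fun v => \sum_(x : 'I_(period d).-1.+1 * 'I_(period d).-1.+1)
    defect (block_start b) (block_len b) v x ^+ 2)); last exact: block_start_le.
  rewrite mean_sum.
  have b_gt0 : 0 < b.+1%:R :> R by rewrite ltr0n.
  apply: (@le_trans _ _ ((2 * b.+1)%:R / N%:R * (1024 * D%:R ^+ 4 *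
     (D%:R ^+ 2 * (114 * c%:R ^+ 2 / b.+1%:R))))); last first.
    rewrite le_eqVlt; apply/orP; left; apply/eqP.
    rewrite natrM; move: (N%:R) (b.+1%:R) N0 b_gt0 => u v u0 v0.
    by field; rewrite !gt_eqF.
  have sum0 : 0 <= \sum_(x : 'I_(period d).-1.+1 * 'I_(period d).-1.+1)
      mean (block_start b.+1) (fun w => defect (block_start b) (block_len b) w x ^+ 2) [::].
    by apply: sumr_ge0 => x _; apply: mean_ge0 => w; rewrite sqr_ge0.
  have len_le : (block_len b)%:R / N%:R <= (2 * b.+1)%:R / N%:R :> R.
    by rewrite ler_pM2r ?invr_gt0 // ler_nat /block_len; lia.
  have per_le : 1024 * (period d)%:R ^+ 4 <= 1024 * D%:R ^+ 4 :> R.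
    apply: (ler_wpM2l (ler0n R 1024)).
    apply: lerXn2r; rewrite ?nnegrE ?ler0n //.
    by rewrite ler_nat.
  have per0 : 0 <= 1024 * (period d)%:R ^+ 4 :> R.
    by apply: mulr_ge0; [exact: (ler0n R 1024) | rewrite exprn_ge0].
  have sum_le : \sum_(x : 'I_(period d).-1.+1 * 'I_(period d).-1.+1)
      mean (block_start b.+1) (fun w => defect (block_start b) (block_len b) w x ^+ 2) [::]
      <= D%:R ^+ 2 * (114 * c%:R ^+ 2 / b.+1%:R).
    apply: le_trans (ler_sum _ (fun x _ => mean_block_defect b x)) _.
    rewrite sumr_const card_prod card_ord prednK // -[_ *+ _]mulr_natl mulnn.
    rewrite ler_wpM2r ?divr_ge0 ?mulr_ge0 ?sqr_ge0 //.
    by rewrite natrX lerXn2r ?nnegrE // ler_nat.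
  apply: (ler_pM _ _ len_le (ler_pM per0 sum0 per_le sum_le)).
    by rewrite divr_ge0.
  exact: mulr_ge0 per0 sum0.
apply: (@le_trans _ _ (D%:R ^+ 6 * \sum_(1 <= d < D.+1) \sum_(0 <= b < B)
   (2 * 1024 * 114 * c%:R ^+ 2 * D%:R ^+ 6 / N%:R))).
  rewrite ler_wpM2l ?exprn_ge0 //; apply: ler_sum_nat => d hd.
  rewrite mean_sum; apply: ler_sum_nat => b /andP[_ bB].
  exact: step.
rewrite le_eqVlt; apply/orP; left; apply/eqP.
move: (2 * 1024 * 114 * c%:R ^+ 2) => u.
rewrite !sumr_const_nat subSS !subn0 -[_ *+ B]mulr_natl -[_ *+ D]mulr_natl.
by rewrite /N /block_start natrX; field; rewrite gt_eqF.
Qed.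

(** * Comparison along a fixed path *)

Lemma sum_blocks (F : nat -> R) B :
  \sum_(0 <= n < block_start B) F n =
  \sum_(0 <= b < B) \sum_(block_start b <= n < block_start b + block_len b) F n.
Proof.
elim: B => [|B IH]; first by rewrite !big_geq.
rewrite [RHS](@big_nat_recr _ _ _ B) //.
rewrite [LHS](@big_cat_nat _ _ _ (block_start B)) //; last exact: block_start_le.
by rewrite IH block_end.
Qed.

(** A bound on fourth powers controls absolute values, linearly and up to a
    threshold, so that it can be averaged over the blocks. *)
Lemma le_fourth (y t : R) : 0 < t -> `|y| <= t + t ^- 3 * y ^+ 4.
Proof.
move=> t0; have -> : y ^+ 4 = `|y| ^+ 4.
  by rewrite !(exprM _ 2 2) real_normK ?num_real.
have := normr_ge0 y; move: `|y| => z z0.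
have t3 : 0 < t ^- 3 by rewrite invr_gt0 exprn_gt0.
case: (leP z t) => [zt|tz].
  by rewrite (le_trans zt) // lerDl mulr_ge0 ?exprn_ge0 // ltW.
apply: (@le_trans _ _ (t ^- 3 * z ^+ 4)); last by rewrite lerDr ltW.
rewrite mulrC ler_pdivlMr ?exprn_gt0 // [z ^+ 4]exprS ler_wpM2l //.
by rewrite lerXn2r // ?nnegrE ltW.
Qed.

Lemma sum_block_weights B : (0 < B)%N ->
  \sum_(0 <= b < B) (block_len b)%:R / (block_start B)%:R = 1 :> R.
Proof.
move=> B0; rewrite -mulr_suml.
have -> : \sum_(0 <= b < B) (block_len b)%:R = (block_start B)%:R :> R.
  have := sum_blocks (fun=> 1) B; rewrite sumr_const_nat subn0 => ->.
  by apply: eq_bigr => b _; rewrite sumr_const_nat addKn.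
by rewrite divff // pnatr_eq0 -lt0n expn_gt0 B0.
Qed.

Section Path.
Variable W : nat -> seq bool.
Hypotheses (sizeW : forall n, size (W n) = n)
  (uptoW : forall m n, (m <= n)%N -> upto m (W n) = W m).
Variable eta : R.
Hypotheses (eta_gt0 : 0 < eta)
  (prob_bound : forall n, eta <= prob true (W n) * prob false (W n)).

Definition frequency d N : R := N%:R^-1 * \sum_(0 <= n < N) (common d (W n))%:R.

Definition density d : R :=
  if (gcdn d c %| gcdn a0 b0)%N then (gcdn d c ^ 2)%:R / (d ^ 2)%:R else 0.

Lemma occupation_deviation d b (x : 'I_(period d).-1.+1 * 'I_(period d).-1.+1) :
  (0 < d)%N ->
  (occupation (block_start b) (block_len b) (W (block_start b.+1)) x
     - ((period d) ^ 2)%:R^-1) ^+ 4 <=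
   eta ^- 2 * (1024 * (period d)%:R ^+ 4 * block_error d b (W (block_start b.+1))).
Proof.
move=> d0; set w := W (block_start b.+1).
set occ := occupation _ _ w.
have wb : upto (block_start b) w = W (block_start b).
  by apply: uptoW; apply: block_start_le.
have := @torus_equidistribution R (period d).-1 occ _ _
  (@occupation_ge0 _ _ _ w) (@sum_occupation _ _ _ (ltn0Sn _) w)
  (prob_ge0 true (W (block_start b))) (prob_ge0 false (W (block_start b)))
  (prob_sum (W (block_start b))) x.
have -> : ((period d).-1.+1 ^ 2)%:R = (period d ^ 2)%:R :> R.
  by rewrite prednK ?period_gt0.
have -> : (period d).-1.+1%:R = (period d)%:R :> R by rewrite prednK ?period_gt0.
have -> : \sum_y (occ y - prob true (W (block_start b)) * occ (back_right y)
    - prob false (W (block_start b)) * occ (back_up y)) ^+ 2 = block_error d b w.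
  rewrite /block_error uptoW //; apply: eq_bigr => y _.
  by rewrite /defect wb.
have hb : eta ^+ 2 <= (prob true (W (block_start b)) * prob false (W (block_start b))) ^+ 2.
  by rewrite lerXn2r ?nnegrE ?(ltW eta_gt0) // mulr_ge0 ?prob_ge0.
set y4 := (_ - _) ^+ 4 => h.
rewrite mulrC ler_pdivlMr ?exprn_gt0 //.
apply: le_trans h; rewrite mulrC ler_wpM2r //.
by rewrite /y4 (exprM _ 2 2) sqr_ge0.
Qed.

(** When [gcd(d, c)] divides both initial coordinates, the frequency of [d] is
    the average over the blocks of the occupation of one residue class; when it
    does not, both the frequency and the density are 0. *)
Lemma frequency_density d B D : (0 < d)%N -> (0 < B)%N -> (0 < D)%N ->
  `|frequency d (block_start B) - density d| <=
  D%:R ^- 2 + eta ^- 2 * (D%:R ^+ 6 * \sum_(0 <= b < B)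
     (block_len b)%:R / (block_start B)%:R *
      (1024 * (period d)%:R ^+ 4 * block_error d b (W (block_start B)))).
Proof.
move=> d0 B0 D0; set N := block_start B.
have D1 : 0 < D%:R :> R by rewrite ltr0n.
have rhs0 : 0 <= \sum_(0 <= b < B) (block_len b)%:R / N%:R *
    (1024 * (period d)%:R ^+ 4 * block_error d b (W N)) :> R.
  apply: sumr_ge0 => b _; apply: mulr_ge0; first by rewrite divr_ge0.
  apply: mulr_ge0; first by apply: mulr_ge0; [exact: (ler0n R 1024) | rewrite exprn_ge0].
  by apply: sumr_ge0 => x _; rewrite sqr_ge0.
have e2 : 0 <= eta ^- 2 by rewrite invr_ge0 exprn_ge0 // ltW.
rewrite /density dvdn_gcd; case: ifP => [/andP[ga gb]|/negbT ng]; last first.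
  have -> : frequency d N = 0.
    rewrite /frequency big1 ?mulr0 // => n _; rewrite /common /coord /=.
    by move: ng; rewrite negb_and => /orP[] /affine_no_residue ->; rewrite ?andbF.
  rewrite subrr normr0 addr_ge0 ?invr_ge0 ?exprn_ge0 //.
  by apply: mulr_ge0 => //; apply: mulr_ge0 => //; rewrite exprn_ge0.
have [i hi] := affine_residue d0 ga.
have [j hj] := affine_residue d0 gb.
have cE w : common d w = (residue (period d).-1 w == (i, j)).
  by rewrite /common /coord /= hi hj -xpair_eqE.
pose y b : R := occupation (block_start b) (block_len b)
  (W (block_start b.+1)) (i, j) - ((period d) ^ 2)%:R^-1.
have -> : frequency d N - (gcdn d c ^ 2)%:R / (d ^ 2)%:R =
    \sum_(0 <= b < B) (block_len b)%:R / N%:R * y b.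
  rewrite /y; under eq_bigr do rewrite mulrBr.
  rewrite sumrB -mulr_suml sum_block_weights // mul1r; congr (_ - _).
    rewrite /frequency sum_blocks mulr_sumr; apply: eq_bigr => b _.
    rewrite /occupation mulrACA divff ?pnatr_eq0 // mul1r; congr (_ * _).
    apply: eq_big_nat => n /andP[_ nb]; rewrite cE uptoW //.
    by rewrite -block_end ltnW.
  have dE : d = (period d * gcdn d c)%N by rewrite divnK // dvdn_gcdl.
  rewrite {2}dE expnMn [X in _ / X]natrM invfM mulrCA divff ?mulr1 //.
  by rewrite pnatr_eq0 -lt0n expn_gt0 gcdn_gt0 d0.
apply: le_trans (ler_norm_sum _ _ _) _.
have t0 : 0 < (D%:R ^+ 2)^-1 :> R by rewrite invr_gt0 exprn_gt0.
have -> : D%:R ^- 2 = \sum_(0 <= b < B) (block_len b)%:R / N%:R * D%:R ^- 2 :> R.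
  by rewrite -mulr_suml sum_block_weights // mul1r.
rewrite !mulr_sumr -big_split /=.
apply: ler_sum_nat => b /andP[_ bB].
rewrite normrM ger0_norm ?divr_ge0 //.
have swap (u v k z : R) : u * (v * (k * z)) = k * (u * (v * z)) by ring.
rewrite swap -mulrDr ler_wpM2l ?divr_ge0 //.
apply: le_trans (le_fourth _ t0) _; rewrite lerD2l exprVn invrK -exprM.
rewrite [leRHS]mulrCA; apply: ler_wpM2l; first by rewrite exprn_ge0.
have := occupation_deviation b (i, j) d0; rewrite -/(y b) => /le_trans; apply.
rewrite /block_error uptoW // uptoW //; exact: block_start_le.
Qed.

Lemma coprime_moebius n M : (total n <= M)%N ->
  (coprime (coord true (W n)) (coord false (W n)))%:R =
  \sum_(1 <= d < M.+1) (moebius d)%:~R * (common d (W n))%:R :> R.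
Proof.
move=> nM; set g := gcdn (coord true (W n)) (coord false (W n)).
have g0 : (0 < g)%N by rewrite gcdn_gt0 coord_gt0.
have gM : (g <= M)%N.
  apply: leq_trans nM; rewrite -[n in X in (_ <= X)%N]sizeW -coord_total.
  by apply: leq_trans (leq_addr _ _); rewrite dvdn_leq ?coord_gt0 // dvdn_gcdl.
rewrite /coprime -/g.
have -> : (g == 1%N)%:R = ((g == 1%N)%:Z)%:~R :> R by [].
rewrite -(sum_moebius g0 gM) rmorph_sum /= big_mkcond /=.
apply: eq_bigr => d _; rewrite /common -dvdn_gcd -/g.
by case: ifP; rewrite ?mulr1 ?mulr0.
Qed.

(** Inserting the frequencies in the Moebius sum; the divisors up to [D] are
    compared with their densities, the other ones are bounded by their
    frequency. *)
Lemma path_estimate B D : (0 < B)%N -> (0 < D)%N ->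
    (D <= total (block_start B))%N ->
  `|(block_start B)%:R^-1 * \sum_(0 <= n < block_start B)
        (coprime (coord true (W n)) (coord false (W n)))%:R
     - Delta_partial R a0 b0 c D| <=
  D%:R^-1 + eta ^- 2 * main_error B D (W (block_start B))
    + tail_error (block_start B) D (W (block_start B)).
Proof.
move=> B0 D0 DM; set N := block_start B; set M := total N.
have D1 : 0 < D%:R :> R by rewrite ltr0n.
have -> : N%:R^-1 * \sum_(0 <= n < N)
    (coprime (coord true (W n)) (coord false (W n)))%:R =
    \sum_(1 <= d < M.+1) (moebius d)%:~R * frequency d N.
  under eq_big_nat => n /andP[_ nN].
    rewrite (@coprime_moebius n M); last first.
      by rewrite /total leq_add2l leq_mul2l ltnW ?orbT.
    over.
  rewrite exchange_big_nat mulr_sumr; apply: eq_bigr => d _.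
  by rewrite -mulr_sumr mulrCA.
have -> : Delta_partial R a0 b0 c D =
    \sum_(1 <= d < D.+1) (moebius d)%:~R * density d.
  rewrite /Delta_partial big_mkcond /=; apply: eq_bigr => d _.
  by rewrite /density; case: ifP => _; rewrite ?mulr0 // mulrAC mulrA.
rewrite (@big_cat_nat _ _ _ D.+1) //= addrAC -sumrB.
apply: le_trans (ler_normD _ _) _; apply: lerD.
  apply: le_trans (ler_norm_sum _ _ _) _.
  apply: (@le_trans _ _ (\sum_(1 <= d < D.+1) (D%:R ^- 2 + eta ^- 2 *
     (D%:R ^+ 6 * \sum_(0 <= b < B) (block_len b)%:R / N%:R *
      (1024 * (period d)%:R ^+ 4 * block_error d b (W N)))))).
    apply: ler_sum_nat => d /andP[d0 _]; rewrite -mulrBr normrM.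
    apply: le_trans (ler_piMl _ (moebius_norm R d)) _ => //.
    exact: frequency_density.
  rewrite big_split /= -!mulr_sumr sumr_const_nat subSS subn0 -[_ *+ D]mulr_natl.
  rewrite -/(main_error B D (W N)) lerD2r expr2 invfM mulrA divff ?mul1r //.
  by rewrite gt_eqF.
apply: le_trans (ler_norm_sum _ _ _) _.
rewrite /tail_error exchange_big_nat mulr_sumr; apply: ler_sum_nat => d /andP[d0 _].
rewrite normrM; apply: le_trans (ler_piMl _ (moebius_norm R d)) _ => //.
rewrite ger0_norm ?mulr_ge0 ?invr_ge0 ?sumr_ge0 // /frequency.
rewrite ler_wpM2l ?invr_ge0 //; apply: ler_sum_nat => n /andP[_ nN].
by rewrite uptoW // ltnW.
Qed.
End Path.

(** * Transfer to the probability space *)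

Section Walk.
Variables (d : measure_display) (T : measurableType d) (P : probability T R).
Variables (Y : nat -> {RV P >-> (nat * nat)%type}) (hY : polya_walk a0 b0 c Y).

Definition position (w : seq bool) : nat * nat := (coord true w, coord false w).

(** A step is read off the first coordinate alone; on the null event where the
    walk makes another jump the bit is meaningless, which [ae_word] excludes. *)
Fixpoint word (n : nat) (o : T) : seq bool :=
  if n is m.+1 then ((Y m o).1 < (Y m.+1 o).1)%N :: word m o else [::].

Fixpoint cylinder (v : seq bool) : set T :=
  if v is x :: u then
    cylinder u `&` [set o | Y (size u).+1 o = position (x :: u)] else setT.

Fixpoint weight (v : seq bool) : R :=
  if v is x :: u then prob x u * weight u else 1.

Lemma size_word n o : size (word n o) = n.
Proof. by elim: n => //= n ->. Qed.

Lemma upto_word m n o : (m <= n)%N -> upto m (word n o) = word m o.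
Proof.
move=> /subnKC <-; elim: (n - m)%N => [|k IH].
  by rewrite addn0 -{1}(size_word m o) upto_id.
by rewrite addnS /= upto_cons // size_word leq_addr.
Qed.

Lemma weight_gt0 v : 0 < weight v.
Proof. by elim: v => //= x v IH; rewrite mulr_gt0 ?prob_gt0. Qed.

Lemma measurable_state n y : measurable [set o | Y n o = y].
Proof.
have -> : [set o | Y n o = y] = Y n @^-1` ([set y.1] `*` [set y.2]).
  apply/seteqP; split => o /=; first by move=> ->.
  by case: y => i j /= []; case: (Y n o) => /= ? ? -> ->.
rewrite -[X in measurable X]setTI; apply: measurable_funP => //.
exact: measurableX.
Qed.

Lemma measurable_cylinder v : measurable (cylinder v).
Proof.
by elim: v => //= x v IH; apply: measurableI => //; apply: measurable_state.
Qed.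

Lemma cylinder_history v :
  cylinder v = history (fun n o => Y n o) (size v) (fun k => position (upto k v)).
Proof.
elim: v => [|x v IH]; apply/seteqP; split => o //=.
- move=> _ k; rewrite leqn0 => /eqP ->; rewrite (polya_start hY).
  by rewrite /position /coord /= !muln0 !addn0.
- move=> [+ ox] k; rewrite leq_eqVlt ltnS => + /orP[/eqP ->|kv].
    by rewrite -[(size v).+1]/(size (x :: v)) upto_id.
  by rewrite IH upto_cons // => /(_ k kv).
- move=> h; split; last first.
    by have := h _ (leqnn _); rewrite -[(size v).+1]/(size (x :: v)) upto_id.
  by rewrite IH => k kv; rewrite h ?leqW // upto_cons.
Qed.

Lemma cylinder_word v o :
  cylinder v o -> word (size v) o = v /\ Y (size v) o = position v.
Proof.
elim: v => [_|x v IH [/IH[wv Yv] Yx]].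
  by split => //=; rewrite (polya_start hY) /position /coord /= !muln0 !addn0.
split=> //=; rewrite wv Yv Yx /= coord_cons; congr cons.
by case: x {Yx} => /=; lia.
Qed.

(** Every history has positive weight, so the conditional probabilities of the
    walk apply at each step of the induction. *)
Lemma prob_cylinder v : P (cylinder v) = (weight v)%:E.
Proof.
elim: v => [|x v IH]; first by rewrite probability_setT.
have hv : (0 < P (history (fun n o => Y n o) (size v) (fun k => position (upto k v))))%E.
  by rewrite -cylinder_history IH lte_fin weight_gt0.
have fin : P (cylinder (x :: v)) \is a fin_num.
  by rewrite fin_num_measure //; apply: measurable_cylinder.
rewrite -(fineK fin) /=; congr EFin; apply/eqP.
have w0 : weight v != 0 by rewrite gt_eqF // weight_gt0.
rewrite -(divfK w0 (fine _)) (inj_eq (mulIf w0)) /=; apply/eqP.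
have ctE : (coord true v + coord false v)%N = total (size v) by exact: coord_total.
case: x fin => fin.
  have := polya_right hY hv; rewrite /cond_prob -cylinder_history IH /= upto_id /= ctE.
  rewrite -/(prob true v) setIC => <-; congr (fine (P (_ `&` _)) / _).
  by rewrite /position !coord_cons /= muln1 muln0 addn0.
have := polya_up hY hv; rewrite /cond_prob -cylinder_history IH /= upto_id /= ctE.
rewrite -/(prob false v) setIC => <-; congr (fine (P (_ `&` _)) / _).
by rewrite /position !coord_cons /= muln1 muln0 addn0.
Qed.

Definition stray v := cylinder v `\` (cylinder (true :: v) `|` cylinder (false :: v)).

Lemma disjoint_steps v : [disjoint cylinder (true :: v) & cylinder (false :: v)].
Proof.
apply/disj_setPS => o [/cylinder_word[ht _] /cylinder_word[hf _]].
by have : true :: v = false :: v by rewrite -ht -hf.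
Qed.

Lemma measurable_stray v : measurable (stray v).
Proof.
by apply: measurableD; [|apply: measurableU]; apply: measurable_cylinder.
Qed.

Lemma sub_cylinder v : cylinder (true :: v) `|` cylinder (false :: v) `<=` cylinder v.
Proof. by move=> o [] []. Qed.

Lemma prob_stray v : P (stray v) = 0%E.
Proof.
have mc u := measurable_cylinder u.
have mU : measurable (cylinder (true :: v) `|` cylinder (false :: v)) by exact: measurableU.
have fin : (P (cylinder v) < +oo)%E by rewrite prob_cylinder ltry.
have eqU : P (cylinder (true :: v) `|` cylinder (false :: v)) = P (cylinder v).
  rewrite measureU //; last exact: (eqP (disjoint_steps v)).
  transitivity ((weight (true :: v))%:E + (weight (false :: v))%:E)%E.
    by congr (_ + _)%E; exact: prob_cylinder.
  by rewrite prob_cylinder -EFinD /= -mulrDl prob_sum mul1r.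
rewrite /stray measureD // setIidr; last exact: sub_cylinder.
transitivity (P (cylinder v) - P (cylinder v))%E; first by congr (_ - _)%E; exact: eqU.
by rewrite prob_cylinder -EFinB subrr.
Qed.

Lemma measurable_word n (h : seq bool -> R) :
  measurable_fun setT (fun o => h (word n o)).
Proof.
elim: n h => [|n IH] h /=; first exact: measurable_cst.
have -> : (fun o => h (((Y n o).1 < (Y n.+1 o).1)%N :: word n o)) =
  (fun o => if ((Y n o).1 < (Y n.+1 o).1)%N then h (true :: word n o)
            else h (false :: word n o)).
  by apply/funext => o; case: ifP.
apply: measurable_fun_ifT; [|exact: (IH (fun w => h (true :: w)))|
  exact: (IH (fun w => h (false :: w)))].
by apply: measurable_fun_ltn; apply: measurableT_comp => //; apply: measurable_funP.
Qed.

(** A cylinder is, up to a null set, the disjoint union of its two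
    continuations: this is the recursion that defines [mean]. *)
Lemma integral_word v n (h : seq bool -> R) : (forall w, 0 <= h w) ->
  (\int[P]_(o in cylinder v) (h (word (size v + n) o))%:E)%E =
  (weight v * mean n h v)%:E.
Proof.
move=> h0; elim: n v => [|n IH] v.
  rewrite addn0 (@eq_integral _ _ _ _ _ (cst (h v)%:E)); last first.
    by move=> o; rewrite inE => /cylinder_word[-> _].
  rewrite integral_cst; last exact: measurable_cylinder.
  transitivity ((h v)%:E * (weight v)%:E)%E.
    by congr (_ * _)%E; exact: prob_cylinder.
  by rewrite -EFinM mulrC.
have mh A : measurable_fun A (EFin \o (fun o => h (word (size v + n.+1) o))).
  by apply/measurable_EFinP; apply: measurable_funTS; apply: measurable_word.
have ge0 o : (0 <= (h (word (size v + n.+1) o))%:E)%E by rewrite lee_fin.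
have -> : cylinder v = (cylinder (true :: v) `|` cylinder (false :: v)) `|` stray v.
  by rewrite /stray setDUK //; apply: sub_cylinder.
have mc u := measurable_cylinder u.
have i0 : (\int[P]_(o in stray v) (h (word (size v + n.+1) o))%:E = 0)%E.
  by apply: null_set_integral; [exact: measurable_stray | exact: mh | exact: prob_stray].
rewrite ge0_integral_setU //; first last.
- by apply/disj_setPS => o [A [_ B]]; apply: B.
- exact: measurable_stray.
- exact: measurableU.
rewrite i0 adde0 ge0_integral_setU //; last exact: disjoint_steps.
have IHx x : (\int[P]_(o in cylinder (x :: v)) (h (word (size v + n.+1) o))%:E)%E =
    (weight (x :: v) * mean n h (x :: v))%:E.
  by rewrite -addSnnS; exact: (IH (x :: v)).
by rewrite !IHx -EFinD; congr EFin; rewrite /=; ring.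
Qed.

Lemma expectation_word n (h : seq bool -> R) : (forall w, 0 <= h w) ->
  (\int[P]_o (h (word n o))%:E)%E = (mean n h [::])%:E.
Proof. by move=> h0; rewrite (@integral_word [::]) //= mul1r. Qed.

Lemma negligible_off_word v n :
  P.-negligible (cylinder v `&` [set o | Y (size v + n) o <> position (word (size v + n) o)]).
Proof.
elim: n v => [|n IH] v.
  rewrite addn0; apply: (negligibleS _ (@negligible_set0 _ _ _ P)).
  by move=> o [/cylinder_word[wv Yv]] /=; rewrite wv Yv.
have mv := measurable_stray v.
have nv : P.-negligible (stray v) by apply/negligibleP => //; apply: prob_stray.
apply: negligibleS (negligibleU (negligibleU (IH (true :: v)) (IH (false :: v))) nv).
move=> o [ov]; rewrite -addSnnS => ho.
have [ht|nt] := pselect (cylinder (true :: v) o); first by left; left.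
have [hf|nf] := pselect (cylinder (false :: v) o); first by left; right.
by right; split => // -[].
Qed.

Lemma ae_word : {ae P, forall o, forall n, Y n o = position (word n o)}.
Proof.
apply: ae_foralln => n; rewrite /almost_everywhere /=.
apply: negligibleS (negligible_off_word [::] n).
by move=> o /= ho; split.
Qed.

(** The sum over [k] has finite expectation, so it is almost surely finite and
    its terms tend to 0. *)
Lemma word_borel_cantelli (h : nat -> seq bool -> R) (t : nat -> nat) (C : R) :
  (forall k w, 0 <= h k w) ->
  (forall k, mean (t k) (h k) [::] <= C * k.+1%:R^-1 ^+ 2) ->
  {ae P, forall o, (fun k => h k (word (t k) o)) @ \oo --> (0 : R)}.
Proof.
move=> h0 hC.
pose f k o := (h k (word (t k) o))%:E.
have f0 k o : (0 <= f k o)%E by rewrite lee_fin.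
have mf k : measurable_fun setT (f k).
  by apply/measurable_EFinP; apply: measurable_word.
have C0 : 0 <= C.
  by have := hC 0%N; rewrite invr1 expr1n mulr1; apply: le_trans; apply: mean_ge0.
have fin : (\int[P]_o (\sum_(0 <= k <oo) f k o) < +oo)%E.
  rewrite integral_nneseries //; apply: (@le_lt_trans _ _ (C * 2)%:E); last exact: ltry.
  apply: lime_le.
    by apply: is_cvg_nneseries => n _ _; apply: integral_ge0.
  apply: nearW => n.
  under eq_bigr do rewrite expectation_word //.
  rewrite sumEFin lee_fin.
  apply: (@le_trans _ _ (\sum_(0 <= k < n) C * k.+1%:R^-1 ^+ 2)).
    by apply: ler_sum => k _; apply: hC.
  by rewrite -mulr_sumr ler_wpM2l // sum_inv_sq_le2.
have int : P.-integrable setT (fun o => \sum_(0 <= k <oo) f k o)%E.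
  apply/integrableP; split.
    exact: ge0_emeasurable_sum.
  under eq_integral do rewrite gee0_abs ?nneseries_ge0 //.
  exact: fin.
have := integrable_ae measurableT int; apply: filterS => o /(_ I) ofin.
apply: (@cvg_series_cvg_0 R R^o).
apply: (@bounded_series_cvg _ _ (fine (\sum_(0 <= k <oo) f k o))%E) => // n.
rewrite -lee_fin fineK // -sumEFin.
by apply: (@nneseries_lim_ge _ (fun k => f k o) xpredT 0 n) => k _ _; apply: f0.
Qed.

Lemma measurable_exceeds g t n : measurable [set o | exceeds g t (word n o)].
Proof.
have m := @measurable_word n (fun w => (exceeds g t w)%:R).
have := m measurableT [set 1] (measurable_set1 _); rewrite setTI.
congr measurable; apply/seteqP; split => o /=.
  by case: exceeds => //= /esym/eqP; rewrite oner_eq0.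
by move=> ->.
Qed.

Lemma prob_exceeds g (t : R) n : 0 < t -> (forall w, 0 <= g w) ->
  (forall w, drift g w <= g w) ->
  (P [set o | exceeds g t (word n o)] <= (g [::] / t)%:E)%E.
Proof.
move=> t0 g0 gs; have mE := measurable_exceeds g t n.
rewrite -[X in (P X <= _)%E]setIT -integral_indic //.
rewrite (@eq_integral _ _ _ _ _ (fun o => (exceeds g t (word n o))%:R%:E)); last first.
  move=> o _; rewrite indicE; congr (_ %:R%:E).
  case: (boolP (exceeds g t (word n o))) => ho; first by rewrite mem_set.
  by rewrite memNset //; apply/negP.
rewrite (@expectation_word n (fun w => (exceeds g t w)%:R)) // lee_fin.
by rewrite ler_pdivlMr // mulrC -meanZ; apply: maximal_inequality.
Qed.

(** The maximal inequality holds up to every finite time with the same bound, so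
    it holds for all times; then the level tends to infinity. *)
Lemma ae_bounded_supermartingale g : (forall w, 0 <= g w) ->
  (forall w, drift g w <= g w) ->
  {ae P, forall o, exists t : R, forall n, g (word n o) <= t}.
Proof.
move=> g0 gs.
pose A (j : nat) := \bigcup_n [set o | exceeds g j.+1%:R (word n o)].
have mA j : measurable (A j).
  by apply: bigcupT_measurable => n; apply: measurable_exceeds.
have PA j : (P (A j) <= (g [::] / j.+1%:R)%:E)%E.
  have inc : {homo (fun n => [set o | exceeds g j.+1%:R (word n o)]) :
      n m / (n <= m)%N >-> (n <= m)%O}.
    move=> n m /subnKC <-; elim: (m - n)%N => [|k IH]; first by rewrite addn0.
    apply: (le_trans IH); apply/subsetPset => o /= ho.
    by rewrite addnS /= ho orbT.
  have cv := nondecreasing_cvg_mu (mu := P) (fun n => measurable_exceeds g j.+1%:R n) (mA j) inc.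
  rewrite -(cvg_lim (@ereal_hausdorff R) cv).
  apply: lime_le; first by apply/cvg_ex; exists (P (A j)).
  by apply: nearW => n; apply: prob_exceeds.
exists (\bigcap_j A j); split; first exact: bigcapT_measurable.
  apply/eqP; rewrite eq_le measure_ge0 andbT.
  apply/lee_addgt0Pr => e e0; rewrite add0e.
  have [j hj] : exists j : nat, g [::] / j.+1%:R <= e.
    exists (Num.truncn (g [::] / e)).
    rewrite ler_pdivrMr // mulrC -ler_pdivrMr //; apply/ltW/truncnS_gt.
  apply: (@le_trans _ _ (P (A j))).
    by apply: le_measure; rewrite ?inE //; [exact: bigcapT_measurable | exact: bigcap_inf].
  by apply: le_trans (PA j) _; rewrite lee_fin.
move=> o /= no j _; apply: contrapT => nA; apply: no.
exists j.+1%:R => n; rewrite leNgt; apply/negP => ltn.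
apply: nA; exists n => //=.
case: (word n o) ltn => [|x w] /= ltn; rewrite ltW //.
Qed.

Lemma ae_prob_bounded : {ae P, forall o, exists2 eta : R, 0 < eta &
  forall n, eta <= prob true (word n o) * prob false (word n o)}.
Proof.
have hx x : {ae P, forall o, exists2 eta : R, 0 < eta &
    forall n, eta <= prob x (word n o)}.
  have := ae_bounded_supermartingale (potential_ge0 x) (drift_potential x).
  apply: filterS => o [t ht].
  have [k k0 hk] := coord_lower_bound x t.
  exists k^-1; first by rewrite invr_gt0.
  move=> n; have := hk _ (ht n); rewrite /prob.
  have s0 : 0 < (total (size (word n o)))%:R :> R by rewrite ltr0n total_gt0.
  by rewrite ler_pdivlMr // -ler_pdivlMl ?invr_gt0 // invrK.
apply: filterS2 (hx true) (hx false) => o [e1 e10 h1] [e2 e20 h2].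
exists (e1 * e2); first by rewrite mulr_gt0.
by move=> n; apply: ler_pM => //; exact: ltW.
Qed.

Lemma ae_path_error (B D : nat -> nat) (C : R) :
  (forall k, (0 < B k)%N) -> (forall k, (0 < D k)%N) ->
  (forall k, mean (block_start (B k)) (fun w => main_error (B k) (D k) w +
      tail_error (block_start (B k)) (D k) w) [::] <= C * k.+1%:R^-1 ^+ 2) ->
  {ae P, forall o, (fun k => main_error (B k) (D k) (word (block_start (B k)) o) +
      tail_error (block_start (B k)) (D k) (word (block_start (B k)) o)) @ \oo --> (0 : R)}.
Proof.
move=> B0 D0 hC; apply: (word_borel_cantelli (C := C) _ hC) => k w.
exact: addr_ge0 (main_error_ge0 _ _ _) (tail_error_ge0 _ _ _).
Qed.

(** * Choice of the scales and conclusion *)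

(** With [K = k.+1], cutoff [K^3] and [K^t] blocks, the main error is of order
    [K^(3 * 13) / K^t]; the exponent [t = 41] makes it [K^-2], and the tail error
    is [O(log K / K^3)]. *)
Section Scales.
Variable t : nat.
Hypothesis t41 : t = 41%N.

Lemma mean_path_error : {C : R | forall k,
  mean (block_start (k.+1 ^ t)) (fun w => main_error (k.+1 ^ t) (k.+1 ^ 3) w +
      tail_error (block_start (k.+1 ^ t)) (k.+1 ^ 3) w) [::] <= C * k.+1%:R^-1 ^+ 2}.
Proof.
pose s := (a0 + b0 + c)%N.
exists (2 * 1024 * 114 * c%:R ^+ 2 + (2 * a0 * b0 * (s + t * 2) * s)%:R) => k.
have K0 : 0 < k.+1%:R :> R by rewrite ltr0n.
have B_gt0 : (0 < k.+1 ^ t)%N by rewrite expn_gt0.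
have D_gt0 : (0 < k.+1 ^ 3)%N by rewrite expn_gt0.
have N_gt0 : (0 < block_start (k.+1 ^ t))%N by rewrite expn_gt0 B_gt0.
have t_gt0 : (0 < t * 2)%N by rewrite t41.
(* [j] bounds the binary logarithm of the total at the horizon. *)
pose j := (s + k.+1 * (t * 2))%N.
have jN : (total (block_start (k.+1 ^ t)) < 2 ^ j)%N.
  apply: (@leq_ltn_trans (s * block_start (k.+1 ^ t))).
    by rewrite /total /s mulnDl leq_add2r leq_pmulr.
  rewrite expnD; apply: (@leq_trans (2 ^ s * block_start (k.+1 ^ t))).
    by rewrite ltn_pmul2r // ltn_expl.
  rewrite leq_pmul2l ?expn_gt0 // /block_start -expnM [X in (_ <= X)%N]expnM.
  by rewrite leq_exp2r // ltnW // ltn_expl.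
rewrite meanD mulrDl; apply: lerD.
  apply: le_trans (mean_main_error _ B_gt0) _.
  rewrite -mulrA; apply: ler_wpM2l.
    exact: (mulr_ge0 (mulr_ge0 (mulr_ge0 (ler0n R 2) (ler0n R 1024)) (ler0n R 114))
      (sqr_ge0 _)).
  rewrite !natrX t41 -exprM (exprD _ 39 2) invfM mulrA divff ?mul1r ?exprVn //.
apply: le_trans (mean_tail_error N_gt0 D_gt0 jN) _.
have -> : (k.+1 ^ 3)%:R^-1 = k.+1%:R^-1 * k.+1%:R^-1 ^+ 2 :> R.
  by rewrite natrX -exprVn exprS.
rewrite mulrA ler_wpM2r ?sqr_ge0 //.
rewrite ler_pdivrMr // -natrM ler_nat -/s.
have js : (j <= (s + t * 2) * k.+1)%N.
  by rewrite /j mulnDl leq_add ?leq_pmulr // mulnC.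
rewrite [X in (_ <= X)%N]mulnAC leq_mul2r -[X in (_ <= X)%N]mulnA leq_mul2l js.
by rewrite !orbT.
Qed.


Lemma cube_le_total k : (k.+1 ^ 3 <= total (block_start (k.+1 ^ t)))%N.
Proof.
apply: (@leq_trans (k.+1 ^ (t * 2))).
  by rewrite leq_pexp2l // t41.
rewrite /total /block_start -expnM; apply: leq_trans (leq_addl _ _).
by rewrite -{1}[(k.+1 ^ _)%N]mul1n leq_mul2r c_gt0 orbT.
Qed.

Lemma ae_path_converges : {ae P, forall o,
  (fun k => (block_start (k.+1 ^ t))%:R^-1 * \sum_(0 <= n < block_start (k.+1 ^ t))
      (coprime_ind (Y n o))%:R) @ \oo --> Delta R a0 b0 c}.
Proof.
have [C hC] := mean_path_error.
have B_gt0 k : (0 < k.+1 ^ t)%N by rewrite expn_gt0.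
have D_gt0 k : (0 < k.+1 ^ 3)%N by rewrite expn_gt0.
apply: filterS3 ae_word ae_prob_bounded (ae_path_error B_gt0 D_gt0 hC).
move=> o wY [eta eta0 heta].
set err := (fun k => _ + _) => err0.
set avg := (fun k => _ * _).
have Dcvg : (fun k => Delta_partial R a0 b0 c (k.+1 ^ 3)) @ \oo --> Delta R a0 b0 c.
  apply: (@cvg_comp _ _ _ (fun k => (k.+1 ^ 3)%N) (Delta_partial R a0 b0 c) \oo \oo);
    last exact: Delta_partial_cvg.
  move=> A [n _ hn]; exists n => // k /= nk; apply: hn => /=.
  apply: leq_trans nk _; apply: leq_trans (leqnSn k) _.
  by rewrite -{1}[k.+1]expn1 leq_pexp2l.
suff diff0 : (fun k => avg k - Delta_partial R a0 b0 c (k.+1 ^ 3)) @ \oo --> (0 : R).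
  have h := cvgD diff0 Dcvg; rewrite add0r in h.
  rewrite (_ : avg = fun k => avg k - Delta_partial R a0 b0 c (k.+1 ^ 3) +
    Delta_partial R a0 b0 c (k.+1 ^ 3)); first exact: h.
  by apply/funext => k; rewrite subrK.
have bound k : `|avg k - Delta_partial R a0 b0 c (k.+1 ^ 3)| <=
    harmonic k + (eta ^- 2 + 1) * err k.
  have := @path_estimate (fun n => word n o) (size_word^~ o)
    (fun m n => @upto_word m n o) eta eta0 heta (k.+1 ^ t) (k.+1 ^ 3)
    (B_gt0 k) (D_gt0 k) (cube_le_total k).
  have -> : (block_start (k.+1 ^ t))%:R^-1 * \sum_(0 <= n < block_start (k.+1 ^ t))
     (coprime (coord true (word n o)) (coord false (word n o)))%:R = avg k.
    by rewrite /avg; congr (_ * _); apply: eq_bigr => n _; rewrite wY.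
  move=> h; apply: le_trans h _; rewrite -addrA; apply: lerD.
    rewrite /harmonic /= lef_pV2 ?posrE ?ltr0n // ler_nat -{1}[k.+1]expn1.
    by rewrite leq_pexp2l.
  have e2 : 0 <= eta ^- 2 by rewrite invr_ge0 exprn_ge0 // ltW.
  have := main_error_ge0 (k.+1 ^ t) (k.+1 ^ 3) (word (block_start (k.+1 ^ t)) o).
  have := tail_error_ge0 (block_start (k.+1 ^ t)) (k.+1 ^ 3)
    (word (block_start (k.+1 ^ t)) o).
  rewrite /err; move: (main_error _ _ _) (tail_error _ _ _) (eta ^- 2) e2.
  by move=> u v z z0 v0 u0; have := mulr_ge0 z0 v0; lra.
have rhs0 : (fun k => harmonic k + (eta ^- 2 + 1) * err k) @ \oo --> (0 : R).
  have := cvgD (@cvg_harmonic R) (cvgM (cvg_cst (eta ^- 2 + 1)) err0).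
  by rewrite mulr0 addr0; exact.
apply/cvgr0Pnorm_lt => e e0.
apply: filterS ((cvgr0Pnorm_lt _).1 rhs0 e e0) => k /=.
by apply: le_lt_trans; apply: le_trans (bound k) (ler_norm _).
Qed.
End Scales.

Lemma ae_average_converges : {ae P, forall o,
  (fun N : nat => N%:R^-1 * \sum_(1 <= n < N.+1) (coprime_ind (Y n o))%:R : R)
    @ \oo --> Delta R a0 b0 c}.
Proof.
have [t t41] : {t | t = 41%N} by exists 41%N.
apply: filterS (ae_path_converges t41) => o.
apply: subsequence_average.
- by move=> n; rewrite /coprime_ind; case: coprime; rewrite /= ?lexx ler01.
- by move=> k; rewrite expn_gt0 expn_gt0.
- move=> k; rewrite /block_start -!expnM ltn_exp2r ?t41 //.
- rewrite /block_start; under eq_fun do rewrite -!expnM.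
  exact: ratio_pow_cvg.
Qed.
End Walk.
End Urn.

Unset Implicit Arguments.

Theorem theorem3 (d : measure_display) (T : measurableType d) (R : realType)
    (P : probability T R) (a0 b0 c : nat)
    (ha0 : (1 <= a0)%N) (hb0 : (1 <= b0)%N) (hc : (1 <= c)%N)
    (Y : nat -> {RV P >-> (nat * nat)%type}) (hY : polya_walk a0 b0 c Y) :
  {ae P, forall w,
    (fun N : nat => N%:R^-1 * \sum_(1 <= n < N.+1) (coprime_ind (Y n w))%:R : R)
      @ \oo --> Delta R a0 b0 c}.
Proof. exact: (@ae_average_converges R a0 b0 c ha0 hb0 hc d T P Y hY). Qed.
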